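(* Let $X,Y\subset\Omega$ be two compact domains in $\mathbb{R}^3$, and suppose that $X$ and $Y$ have disjoint projections onto the $xy$-plane. For any $\varepsilon>0$ and $\delta>0$, for all sufficiently large $n$ there exist $N^{\varepsilon}\le O(n^{3+\delta})$ and functions $f_l\in L^{\infty}(X)$, $g_l\in L^{\infty}(Y)$, $l=1,2,\dots,N^{\varepsilon}$, such that $$\Big\|G_{n0}(\mathbf{x},\mathbf{y})-\sum_{l=1}^{N^{\varepsilon}}f_l(\mathbf{x})\,g_l(\mathbf{y})\Big\|_{L^{\infty}(X\times Y)}\le\varepsilon,$$ where the constant in the upper bound for $N^{\varepsilon}$ depends on $X$ and $Y$.
   Context: $\Omega\subset\mathbb{R}^3$ is a bounded convex domain. The coefficient $\sigma_t$ is a real-valued function in $C^{k+1}(\overline{\Omega})$ with $k\ge1$ an integer, and $0<\sigma_0\le\sigma_t\le\sigma_1<\infty$ for some constants $\sigma_0,\sigma_1$; $\Omega$ and $\sigma_t$ are fixed. For $\mathbf{x}\ne\mathbf{y}$ in $\Omega$ set $$E(\mathbf{x},\mathbf{y})=\exp\Big(-|\mathbf{x}-\mathbf{y}|\int_0^1\sigma_t(\mathbf{x}+(\mathbf{y}-\mathbf{x})s)\,ds\Big),\qquad G_{n0}(\mathbf{x},\mathbf{y})=\frac{E(\mathbf{x},\mathbf{y})}{|\mathbf{x}-\mathbf{y}|^2}\,Y_{n0}\Big(\frac{\mathbf{x}-\mathbf{y}}{|\mathbf{x}-\mathbf{y}|}\Big),$$ where $Y_{n0}(\theta,\phi)=\sqrt{\tfrac{2n+1}{4\pi}}\,P_n(\cos\theta)$,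 $\theta$ is the polar angle measured from the $z$-axis, $\phi$ the azimuthal angle, and $P_n$ the Legendre polynomial of degree $n$. ''$N^{\varepsilon}\le O(n^{3+\delta})$'' means $N^{\varepsilon}\le C n^{3+\delta}$ with $C$ independent of $n$. *)

(* Defs.v *)
From HB Require Import structures.
From mathcomp Require Import all_boot all_order all_algebra.
From mathcomp Require Import all_classical all_reals all_analysis.

Set Implicit Arguments.
Unset Strict Implicit.
Unset Printing Implicit Defensive.

Import Order.TTheory GRing.Theory Num.Theory.
Import numFieldNormedType.Exports.

Local Open Scope classical_set_scope.
Local Open Scope ring_scope.

(* Points are ((x, y), z), so [fst] is the projection onto the xy-plane. The
   library norm on this product is the max norm; it is used only for topological
   notions (boundedness, closure, derivatives), which agree with the Euclidean
   ones. Distances are measured with [enorm]. *)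
Notation space3 R := (R * R * R)%type.

(* The library's own sigma-finite instance on product measures is not found by
   inference: a later instance for products of subprobabilities shadows it. *)
Lemma sigma_finite_prod d1 d2 (T1 : measurableType d1) (T2 : measurableType d2)
    (R : realType) (m1 : {sigma_finite_measure set T1 -> \bar R})
    (m2 : {sigma_finite_measure set T2 -> \bar R}) :
  sigma_finite [set: T1 * T2] (m1 \x m2)%E.
Proof.
have /sigma_finiteP[F [TF ndF Foo]] := sigma_finiteT m1.
have /sigma_finiteP[G [TG ndG Goo]] := sigma_finiteT m2.
exists (fun n => F n `*` G n).
  rewrite -setXTT TF TG predeqE => -[x y]; split.
    move=> [/= [n _ Fnx] [k _ Gky]]; exists (maxn n k) => //; split.
    - by move: x Fnx; exact/subsetPset/ndF/leq_maxl.
    - by move: y Gky; exact/subsetPset/ndG/leq_maxr.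
  by move=> [n _ []/= ? ?]; split; exists n.
move=> k; have [? ?] := Foo k; have [? ?] := Goo k.
split; first exact: measurableX.
by rewrite product_measure1E// lte_mul_pinfty// ge0_fin_numE.
Qed.

(* [measurableTypeR R] is R with the Borel sigma-algebra on which the library
   defines [lebesgue_measure]. *)
Notation mspace3 R :=
  (measurableTypeR R * measurableTypeR R * measurableTypeR R)%type.

Definition area {R : realType} :
    set (measurableTypeR R * measurableTypeR R)%type -> \bar R :=
  (lebesgue_measure \x lebesgue_measure)%E.

HB.instance Definition _ (R : realType) := Measure.on (@area R).
HB.instance Definition _ (R : realType) :=
  Measure_isSigmaFinite.Build _ _ _ (@area R) (sigma_finite_prod _ _).

Definition volume {R : realType} : set (mspace3 R) -> \bar R :=
  (area \x lebesgue_measure)%E.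

HB.instance Definition _ (R : realType) := Measure.on (@volume R).
HB.instance Definition _ (R : realType) :=
  Measure_isSigmaFinite.Build _ _ _ (@volume R) (sigma_finite_prod _ _).

Section Space.
Context {R : realType}.
Implicit Types (x y u : space3 R) (A : set (space3 R)).

Definition enorm x : R := Num.sqrt (x.1.1 ^+ 2 + x.1.2 ^+ 2 + x.2 ^+ 2).

Definition domain A := [/\ open A, connected A & A !=set0].

Definition compact_domain A :=
  compact A /\ exists2 U, domain U & A = closure U.

(* f is in C^m(closure A): the partial derivatives of order at most m exist in A
   and extend continuously to the closure (g is the extended first derivative;
   only the values of f on the closure matter). *)
Fixpoint Cclosure (m : nat) A (f : space3 R -> R) : Prop :=
  {within closure A, continuous f} /\
  if m is m'.+1 then
    forall e : space3 R, e \in [:: (1, 0, 0); (0, 1, 0); (0, 0, 1)] ->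
    exists2 g : space3 R -> R,
      (forall x, A x -> is_derive x e f (g x)) & Cclosure m' A g
  else True.

(* Only the values of f on A matter: [f \_ A] is the extension of [f] by 0. *)
Definition Linfty A (f : space3 R -> R) : Prop := f \_ A \in Lfun volume +oo%E.

Definition Linfty_norm2 A B (h : space3 R -> space3 R -> R) : \bar R :=
  'N[(volume \x volume)%E]_+oo%E [EFin \o ((fun p => h p.1 p.2) \_ (A `*` B))].

(* Rodrigues' formula *)
Definition legendre (n : nat) : {poly R} :=
  (2 ^+ n * n`!%:R)^-1 *: (('X ^+ 2 - 1) ^+ n)^`(n).

(* angle from the z-axis, for a unit vector u *)
Definition polar_angle u : R := acos u.2.

Definition Yn0 (n : nat) u : R :=
  Num.sqrt ((2 * n%:R + 1) / (4 * pi)) * (legendre n).[cos (polar_angle u)].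

Definition attenuation (sigma_t : space3 R -> R) x y : R :=
  expR (- enorm (x - y) *
    \int[lebesgue_measure]_(s in `[0, 1]) sigma_t (x + s *: (y - x))).

Definition Gn0 (sigma_t : space3 R -> R) (n : nat) x y : R :=
  attenuation sigma_t x y / enorm (x - y) ^+ 2
  * Yn0 n ((enorm (x - y))^-1 *: (x - y)).

End Space.

(* Main.v *)
Require Import Defs.
From HB Require Import structures.
From mathcomp Require Import all_boot all_order all_algebra.
From mathcomp Require Import all_classical all_reals all_analysis.
From mathcomp Require Import measurable_realfun ess_sup_inf polyrcf ring lra zify.

Import Order.TTheory GRing.Theory Num.Theory.
Import numFieldNormedType.Exports.

Local Open Scope classical_set_scope.
Local Open Scope ring_scope.

Set Implicit Arguments.
Unset Strict Implicit.
Unset Printing Implicit Defensive.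

(** Write G_n0 = F * Y, with F(x,y) = E(x,y) / |x-y|^2 and Y the value of Y_n0 at
    (x-y)/|x-y|, that is sqrt((2n+1)/(4 pi)) P_n(z/r) for z the last coordinate
    of x-y and r = |x-y|.  The factor F depends on neither n nor the angle and
    is uniformly continuous on X * Y, whereas Y oscillates at frequency n.

    Cut X and Y into finitely many small cells, whose number K depends on eps
    but not on n.  On a product of two cells two things happen.

    - F is nearly constant.  Replacing it by a constant costs the oscillation of
      F times the maximum of |Y|, and this maximum is bounded independently of n:
      since the projections of X and Y are disjoint, x-y stays away from the
      vertical axis, and n (1 - t^2) P_n(t)^2 <= 1 ([legendre_le]).
    - r^2 is nearly a constant c, so P_n(z/r) is a sum of terms
      p_j z^j (r^2)^(-j/2) where (r^2)^(-j/2) is close to a polynomial of degree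
      n in r^2.  The ratio of r^2 to c is so close to 1 that the truncation error
      beats the growth 4^n of the coefficients p_j, and the total error is
      O(4^-n) ([legendre_local_approx]).  The approximant is a polynomial of
      degree at most 3n in each coordinate of x-y, so expanding it in monomials of
      x gives a sum of (3n+1)^3 products f(x) g(y) ([separated_horner_sqdist]).

    Summing over pairs of cells, with indicator functions as cut-offs, gives
    K^2 (3n+1)^3 terms ([glue_cells]).  The factor n^delta absorbs the constant
    64 K^2 as soon as n is large ([rank_bound]), so that C = 1 works. *)

(** * Legendre polynomials: differential equation and coefficients *)

Lemma derivnMX (R : comNzRingType) (p : {poly R}) m :
  ('X * p)^`(m) = 'X * p^`(m) + p^`(m.-1) *+ m.
Proof.
case: m => [|m]; first by rewrite !derivn0 mulr0n addr0.
by have := derivnMXaddC m p 0; rewrite addr0 (mulrC p) (mulrC p^`(m.+1)) addrC.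
Qed.

(** v = (X^2 - 1)^n solves the first-order equation (X^2 - 1) v' = 2 n X v;
    the product on the left is expanded so that [derivnMX] applies to each
    term. *)
Lemma deriv_X2B1_exp (R : comNzRingType) n
    (v := ('X ^+ 2 - 1) ^+ n : {poly R}) :
  'X * ('X * v^`()) - v^`() = 'X * v *+ (2 * n).
Proof.
rewrite /v; case: n v => [|n] v.
  by rewrite expr0 muln0 mulr0n derivC !mulr0 subr0.
rewrite deriv_exp derivB derivXn derivC subr0 expr1.
rewrite -[n.+1.-1]/n (exprS _ n).
move: (_ ^+ n) => w.
ring.
Qed.

(** The Leibniz rule applied n+1 times to (X^2 - 1) v' = 2 n X v. Each factor
    has degree at most 2, so at most three terms survive. *)
Lemma Rodrigues_ode (R : comNzRingType) n
    (p := (('X ^+ 2 - 1) ^+ n)^`(n) : {poly R}) :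
  (1 - 'X ^+ 2) * p^`()^`() = 'X * p^`() *+ 2 - p *+ (n * n.+1).
Proof.
have := congr1 (derivn n.+1) (deriv_X2B1_exp R n).
rewrite /p; move: (_ ^+ n) => v.
rewrite derivnB derivnMn !derivnMX -!derivnS !succnK -!derivSn.
have -> : v^`(n.-1.+1) *+ n = v^`(n) *+ n by case: (n).
move: v^`(n) v^`(n.+1) v^`(n.+2) => a b c.
move=> E; transitivity ('X * b *+ 2 - a *+ (n * n.+1)
  + (('X * b + a *+ n.+1) *+ (2 * n)
  - ('X * ('X * c + b *+ n.+1) + ('X * b + a *+ n) *+ n.+1 - c)));
    first by ring.
by rewrite E subrr addr0.
Qed.

(** Divided derivatives trade the factorials for binomial coefficients, for
    which the bounds below are immediate. *)
Lemma legendreE (R : realType) n :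
  @legendre R n = (2 ^+ n)^-1 *: (('X ^+ 2 - 1) ^+ n)^`N(n).
Proof.
have f0 : n`!%:R != 0 :> R by rewrite pnatr_eq0 -lt0n fact_gt0.
rewrite /legendre nderivn_def -[_^`N(n) *+ _]scaler_nat scalerA invfM -mulrA.
by rewrite mulVf // mulr1.
Qed.

(** Pascal's rule, up to signs. *)
Lemma normr_coef_XB1_exp (R : realDomainType) n i :
  `|(('X - 1) ^+ n : {poly R})`_i| <= 'C(n, i)%:R.
Proof.
elim: n i => [|n IH] i.
  by rewrite expr0 coef1 bin0n normr_nat.
rewrite exprS mulrBl mul1r coefB coefXM.
case: i => [|i] /=.
  by rewrite sub0r normrN (le_trans (IH _)) // !bin0.
by rewrite binS addnC natrD (le_trans (ler_normB _ _)) // lerD.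
Qed.

Lemma normr_coef_X2B1_exp (R : realDomainType) n i :
  `|(('X ^+ 2 - 1) ^+ n : {poly R})`_i| <= if odd i then 0 else 'C(n, i./2)%:R.
Proof.
have -> : ('X ^+ 2 - 1) ^+ n = (('X - 1) ^+ n) \Po 'X^2 :> {poly R}.
  by rewrite rmorphXn rmorphB /= comp_polyX rmorph1.
rewrite coef_comp_poly_Xn // dvdn2 divn2.
by case: (odd i) => /=; rewrite ?normr0 // normr_coef_XB1_exp.
Qed.

Lemma coef_legendre (R : realType) n i :
  (@legendre R n)`_i =
  (2 ^+ n)^-1 * ((('X ^+ 2 - 1) ^+ n)`_(n + i) *+ 'C(n + i, n)).
Proof. by rewrite legendreE coefZ coef_nderivn. Qed.

Lemma size_legendre (R : realType) n : (size (@legendre R n) <= n.+1)%N.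
Proof.
apply/leq_sizeP => j nj; rewrite coef_legendre nth_default ?mul0rn ?mulr0 //.
have sz : (size (('X ^+ 2 - 1) ^+ n : {poly R})).-1 = (2 * n)%N.
  by rewrite size_exp -polyC1 size_XnsubC.
by rewrite (leq_trans (leqSpred _)) // sz; lia.
Qed.

Lemma bin_le_exp2 n i : ('C(n, i) <= 2 ^ n)%N.
Proof.
case: (leqP i n) => [le_in|?]; last by rewrite bin_small.
rewrite -[2%N]/(1 + 1)%N Pascal (bigD1 (Ordinal (le_in : (i < n.+1)%N))) //=.
by rewrite !exp1n !muln1 leq_addr.
Qed.

Lemma normr_coef_legendre_le (R : realType) n i :
  `|(@legendre R n)`_i| <= 4 ^+ n.
Proof.
case: (ltnP i n.+1) => [lein|?]; last first.
  by rewrite nth_default ?normr0 ?exprn_ge0 // (leq_trans (size_legendre _ _)).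
have n2 : 0 < 2 ^+ n :> R by rewrite exprn_gt0.
rewrite coef_legendre normrM gtr0_norm ?invr_gt0 // ler_pdivrMl //.
rewrite normrMn -[_ *+ _]mulr_natr; apply: ler_pM => //.
  apply: (le_trans (normr_coef_X2B1_exp _ _ _)).
  by case: odd; rewrite ?exprn_ge0 // -natrX ler_nat bin_le_exp2.
rewrite -natrX ler_nat (leq_trans (bin_le_exp2 _ _)) //.
by rewrite -[4%N]/(2 ^ 2)%N -expnM leq_exp2l //; lia.
Qed.

(** C(2m,m) / 4^m decreases like the inverse square root of m; the factor 2m+1
    makes the induction close, as (2m+1)(2m+3) <= (2m+2)^2. *)
Lemma central_bin_sqr m : ((2 * m).+1 * 'C(2 * m, m) ^ 2 <= 16 ^ m)%N.
Proof.
elim: m => [//|m IH].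
have e : (m.+1 * 'C(2 * m.+1, m.+1) = 2 * (2 * m).+1 * 'C(2 * m, m))%N.
  have -> : (2 * m.+1 = (2 * m).+2)%N by lia.
  have := mul_bin_diag (2 * m) m; rewrite -/(_ .+1) => e1.
  have := mul_bin_diag (2 * m).+1 m => /=; rewrite !binS => e2.
  have e3 := mul_bin_left (2 * m) m.
  have := mul_bin_left (2 * m).+1 m; rewrite !binS; nia.
rewrite -(@leq_pmul2l (m.+1 ^ 2)) // (expnS 16).
move: 'C(2 * m.+1, m.+1) 'C(2 * m, m) (16 ^ m)%N e IH => a b c e IH.
have -> : (m.+1 ^ 2 * ((2 * m.+1).+1 * a ^ 2)
  = (2 * m.+1).+1 * (m.+1 * a) ^ 2)%N by rewrite !expnS !expn0; lia.
rewrite e.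
have -> : ((2 * m.+1).+1 * (2 * (2 * m).+1 * b) ^ 2 =
  4 * (2 * m.+1).+1 * (2 * m).+1 * ((2 * m).+1 * b ^ 2))%N.
  by rewrite !expnS !expn0; lia.
apply: (@leq_trans (4 * (2 * m.+1).+1 * (2 * m).+1 * c)).
  by rewrite leq_mul2l IH orbT.
by rewrite mulnA leq_mul2r; apply/orP; right; rewrite !expnS expn0; lia.
Qed.

Lemma legendre_ode (R : realType) n : let p := @legendre R n in
  (1 - 'X ^+ 2) * p^`()^`() = 'X * p^`() *+ 2 - p *+ (n * n.+1).
Proof.
rewrite /legendre !linearZ /= -scalerAr Rodrigues_ode scalerBr.
by rewrite -!scalerMnr -scalerAr.
Qed.

(** This sharper form of the coefficient bound keeps the parity and serves for
    i = 0 and i = 1, that is for the value and the slope at 0. *)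
Lemma normr_coef_legendre_sub_le (R : realType) n i :
  `|(@legendre R n)`_i| <=
  if odd (n + i) then 0 else 'C(n, (n + i)./2)%:R * 'C(n + i, n)%:R / 2 ^+ n.
Proof.
have n2 : 0 < 2 ^+ n :> R by rewrite exprn_gt0.
rewrite coef_legendre normrM gtr0_norm ?invr_gt0 // mulrC normrMn.
rewrite -[_ *+ _]mulr_natr.
have := normr_coef_X2B1_exp R n (n + i).
case: odd => h.
  by rewrite (le_anti (introT andP (conj h (normr_ge0 _)))) !mul0r.
by rewrite ler_pM2r ?invr_gt0 // ler_wpM2r.
Qed.

(** * Decay of Legendre polynomials inside the interval *)

(** One of P_n(0) and P_n'(0) vanishes by parity, and the other is a central
    binomial coefficient over a power of 2, which decays like n^(-1/2). *)
Lemma legendre_energy0_le (R : realType) n (p := @legendre R n) : (0 < n)%N ->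
  (n * n.+1)%:R * p.[0] ^+ 2 + p^`().[0] ^+ 2 <= n.+1%:R.
Proof.
move=> n0; have p0 := normr_coef_legendre_sub_le R n 0.
have := normr_coef_legendre_sub_le R n 1.
rewrite !horner_coef0 coef_deriv mulr1n -!/p => p1.
have [on|en] := boolP (odd n).
  have {p0} p00 : p`_0 = 0.
    by apply/eqP; rewrite -normr_le0; move: p0; rewrite addn0 on.
  rewrite p00 expr0n mulr0 add0r -(real_normK (num_real _)).
  move: p1; rewrite addn1 /= on /= binSn.
  have [m nE] : exists m, n = (2 * m).+1.
    by exists n./2; rewrite -[LHS]odd_double_half on -mul2n.
  have -> : (uphalf n = m.+1) by lia.
  have cb : (2 * 'C(n, m.+1) = 'C(2 * m.+1, m.+1))%N.
    have -> : (2 * m.+1 = n.+1)%N by lia.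
    have e : 'C(n, m) = 'C(n, m.+1).
      by rewrite -(@bin_sub n m); [congr ('C(_, _)); lia | lia].
    by rewrite binS e mul2n addnn.
  have := central_bin_sqr m.+1; rewrite -cb => h le.
  apply: (@le_trans _ _ (('C(n, m.+1)%:R * n.+1%:R / 2 ^+ n) ^+ 2)).
    by rewrite ler_sqr // nnegrE ?divr_ge0 ?mulr_ge0 ?exprn_ge0.
  rewrite expr_div_n ler_pdivrMr ?exprn_gt0 // -natrM -!natrX -natrM ler_nat.
  have e4 : (4 * (2 ^ n) ^ 2 = 16 ^ m.+1)%N.
    by rewrite -expnM -(expnD 2 2) -(expnM 2 4); congr (2 ^ _)%N; lia.
  move: h e4; rewrite !expnS !expn0;
    move: (2 ^ n)%N (16 ^ _)%N 'C(_, _) => a c b; nia.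
have {p1} p10 : p`_1 = 0.
  by apply/eqP; rewrite -normr_le0; move: p1; rewrite addn1 /= en.
rewrite p10 expr0n addr0 -(real_normK (num_real _)).
move: p0; rewrite addn0 (negPf en) binn mulr1.
have [m nE] : exists m, n = (2 * m)%N.
  by exists n./2; rewrite -[LHS]odd_double_half (negPf en) -mul2n.
have -> : n./2 = m by lia.
have := central_bin_sqr m; rewrite -nE => h le.
apply: (@le_trans _ _ ((n * n.+1)%:R * ('C(n, m)%:R / 2 ^+ n) ^+ 2)).
  by rewrite ler_pM2l ?ltr0n ?muln_gt0 ?n0 // ler_sqr //
    nnegrE ?divr_ge0 ?mulr_ge0 ?exprn_ge0.
rewrite expr_div_n mulrA ler_pdivrMr ?exprn_gt0 // -!natrX -!natrM ler_nat.
have e4 : ((2 ^ n) ^ 2 = 16 ^ m)%N.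
  by rewrite -expnM -(expnM 2 4); congr (2 ^ _)%N; lia.
rewrite e4 -mulnA (leq_trans (leq_mul (leqnn n) h)) //.
by rewrite leq_mul2r leqnSn orbT.
Qed.

(** With N = n(n+1), the energy K = N (1-t^2) P^2 + ((1-t^2) P')^2 satisfies
    K' = -2 N t P^2 by the differential equation, so it is largest at t =
    0, where it is at most n+1. This is a weak form of Bernstein's
    inequality, with 1 - t^2 instead of its square root. *)
Lemma legendre_le (R : realType) n (t : R) (p := @legendre R n) :
  n%:R * (1 - t ^+ 2) * p.[t] ^+ 2 <= 1.
Proof.
have [->|n0] := posnP n; first by rewrite !mul0r ler01.
pose K := (1 - 'X ^+ 2) * p ^+ 2 *+ (n * n.+1) + ((1 - 'X ^+ 2) * p^`()) ^+ 2.
have dK : K^`() = - (('X * p ^+ 2) *+ (2 * (n * n.+1))).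
  rewrite /K derivD derivMn derivM !deriv_exp derivB derivXn derivM derivB
    derivXn.
  rewrite -polyC1 derivC polyC1 sub0r.
  (* the second summand is a multiple of the differential equation *)
  transitivity (- (('X * p ^+ 2) *+ (2 * (n * n.+1)))
    + (1 - 'X ^+ 2) * p^`() *+ 2 * ((1 - 'X ^+ 2) * p^`()^`()
        - ('X * p^`() *+ 2 - p *+ (n * n.+1)))); first by ring.
  by rewrite (legendre_ode R n) subrr mulr0 addr0.
have K0 : K.[t] <= K.[0].
  have dKE c : K^`().[c] = - ((c * p.[c] ^+ 2) *+ (2 * (n * n.+1))).
    by rewrite dK hornerN hornerMn hornerM hornerX horner_exp.
  have [t0|t0|->] := ltrgt0P t.
  - have [c] := poly_mvt K t0; rewrite in_itv /= subr0 dKE => /andP[c0 _] E.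
    rewrite -subr_le0 E mulNr oppr_le0; apply: mulr_ge0; last exact: ltW.
    rewrite mulrn_wge0 //.
    by rewrite mulr_ge0 ?sqr_ge0 // ltW.
  - have [c] := poly_mvt K t0; rewrite in_itv /= sub0r dKE => /andP[_ c0] E.
    rewrite -subr_ge0 E mulrNN; apply: mulr_le0; last exact: ltW.
    by rewrite mulrn_wle0 // mulr_le0_ge0 ?sqr_ge0 // ltW.
  - by [].
have := le_trans K0 (_ : _ <= n.+1%:R).
rewrite /K !(hornerD, hornerMn, horner_exp, hornerM, hornerN, hornerX, hornerC)
  expr0n.
rewrite subr0 !mul1r -[X in X + _]mulr_natl.
move=> /(_ (legendre_energy0_le R n0)).
move=> h; rewrite -(@ler_pM2l _ n.+1%:R) // mulr1 (le_trans _ h) //.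
rewrite -[leLHS]addr0 lerD ?sqr_ge0 // le_eqVlt; apply/orP; left; apply/eqP.
ring.
Qed.

(** * Polynomials with nonnegative coefficients close to (1 - X)^(-1/2) *)

(** Newton's iteration a <- a (3 - (1-X) a^2) / 2 for the inverse square root
    of 1 - X, started at 1. In terms of the residue e = 1 - (1-X) a^2 it
    reads a <- a (1 + e/2), e <- (3 e^2 + e^3) / 4. In this form all
    coefficients are visibly nonnegative, so that the values at 1/2
    control everything on the interval [-1/2, 1/2]. *)
Fixpoint rsqrt_residue (R : fieldType) k : {poly R} :=
  if k is k'.+1 then
    4^-1 *: (rsqrt_residue R k' ^+ 2 *+ 3 + rsqrt_residue R k' ^+ 3)
  else 'X.

Fixpoint rsqrt_newton (R : fieldType) k : {poly R} :=
  if k is k'.+1 then rsqrt_newton R k' * (1 + 2^-1 *: rsqrt_residue R k')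
    else 1.

Lemma rsqrt_newtonE (R : numFieldType) k :
  (1 - 'X) * rsqrt_newton R k ^+ 2 = 1 - rsqrt_residue R k.
Proof.
elim: k => [|k IH] /=; first by rewrite expr1n mulr1.
rewrite exprMn mulrA IH -!mul_polyC.
have h4 : (4^-1)%:P = (2^-1)%:P ^+ 2 :> {poly R}.
  by rewrite -polyC_exp; congr polyC; rewrite exprVn -natrX.
have h2 : (2^-1)%:P *+ 2 = 1 :> {poly R}.
  by rewrite -polyCMn -(mulr_natr 2^-1) mulVf ?pnatr_eq0.
move: h2; rewrite h4; move: (2^-1)%:P => h h2.
move: (rsqrt_residue R k) => e.
(* (1 - e) (1 + h e)^2 expanded, up to a multiple of 2 h - 1 = 0 *)
transitivity (1 - h ^+ 2 * (e ^+ 2 *+ 3 + e ^+ 3)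
  + (h *+ 2 - 1) * (e + h *+ 2 * e ^+ 2)); first by ring.
by rewrite h2 subrr mul0r addr0.
Qed.

Definition coef_ge0 (R : numDomainType) (p : {poly R}) := forall i, 0 <= p`_i.

Lemma coef_ge0C (R : numDomainType) (c : R) : 0 <= c -> coef_ge0 c%:P.
Proof. by move=> c0 i; rewrite coefC; case: eqP. Qed.

Lemma coef_ge0D (R : numDomainType) (p q : {poly R}) :
  coef_ge0 p -> coef_ge0 q -> coef_ge0 (p + q).
Proof. by move=> p0 q0 i; rewrite coefD addr_ge0. Qed.

Lemma coef_ge0M (R : numDomainType) (p q : {poly R}) :
  coef_ge0 p -> coef_ge0 q -> coef_ge0 (p * q).
Proof. by move=> p0 q0 i; rewrite coefM sumr_ge0 // => j _;
  rewrite mulr_ge0. Qed.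

Lemma coef_ge0Z (R : numDomainType) (c : R) (p : {poly R}) :
  0 <= c -> coef_ge0 p -> coef_ge0 (c *: p).
Proof. by move=> c0 p0 i; rewrite coefZ mulr_ge0. Qed.

Lemma coef_ge0X (R : numDomainType) (p : {poly R}) n :
  coef_ge0 p -> coef_ge0 (p ^+ n).
Proof.
move=> p0; elim: n => [|n IH]; first by rewrite expr0 -polyC1; exact: coef_ge0C.
by rewrite exprS; exact: coef_ge0M.
Qed.

Lemma rsqrt_residue_ge0 (R : numFieldType) k : coef_ge0 (rsqrt_residue R k).
Proof.
elim: k => [|k IH] /=; first by move=> i; rewrite coefX ler0n.
apply: coef_ge0Z; first by rewrite invr_ge0.
apply: coef_ge0D; last exact: coef_ge0X.
by move=> i; rewrite coefMn mulrn_wge0 //; exact: coef_ge0X.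
Qed.

Lemma rsqrt_newton_ge0 (R : numFieldType) k : coef_ge0 (rsqrt_newton R k).
Proof.
elim: k => [|k IH] /=; first by rewrite -polyC1; exact: coef_ge0C.
apply: coef_ge0M => //; apply: coef_ge0D; first by rewrite -polyC1;
  exact: coef_ge0C.
by apply: coef_ge0Z; [rewrite invr_ge0 | exact: rsqrt_residue_ge0].
Qed.

Lemma normr_horner_nneg_le (R : numDomainType) (p : {poly R}) x r :
  coef_ge0 p -> `|x| <= r -> `|p.[x]| <= p.[r].
Proof.
move=> p0 xr; rewrite !horner_coef.
apply: le_trans (ler_norm_sum _ _ _) _; apply: ler_sum => i _.
rewrite normrM ger0_norm // normrX ler_wpM2l //.
by rewrite lerXn2r // nnegrE // (le_trans _ xr).
Qed.

(** Each term of degree at least d is at most (|x|/r)^d times its value at r,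
    and the terms at r are nonnegative with sum p(r). *)
Lemma horner_nneg_tail_le (R : numFieldType) (p : {poly R}) d x r :
  coef_ge0 p -> 0 < r -> `|x| <= r ->
  `|p.[x] - (take_poly d p).[x]| <= (`|x| / r) ^+ d * p.[r].
Proof.
move=> p0 r0 xr.
have d0 : coef_ge0 (drop_poly d p) by move=> i; rewrite coef_drop_poly.
have t0 : coef_ge0 (take_poly d p).
  by move=> i; rewrite coef_take_poly; case: ifP.
rewrite -[in p.[x]](poly_take_drop d p) hornerD addrC addKr hornerM hornerXn.
rewrite normrM normrX expr_div_n mulrC -mulrA ler_wpM2l ?exprn_ge0 //.
rewrite mulrC ler_pdivlMr ?exprn_gt0 //.
rewrite -[X in _ <= X.[r]](poly_take_drop d p) hornerD hornerM hornerXn.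
rewrite -[leLHS]add0r lerD //.
  by rewrite (le_trans _ (normr_horner_nneg_le (x := 0) (r := r) t0 _)) //
    normr0 ltW.
by rewrite ler_pM2r ?exprn_gt0 // normr_horner_nneg_le.
Qed.

(** The residue decays quadratically, but halving at each step is all that is
    used. *)
Lemma rsqrt_residue_half (R : realFieldType) k :
  0 <= (rsqrt_residue R k).[2^-1] <= 2^-1 ^+ k.+1.
Proof.
elim: k => [|k /andP[e0 IH]] /=;
  first by rewrite hornerX expr1 lexx invr_ge0 ler0n.
rewrite !(hornerZ, hornerD, hornerMn, horner_exp).
move: (_.[_]) e0 IH => e e0 IH.
have e1 : e <= 2^-1.
  have : (2^-1 : R) ^+ k <= 1 by apply: exprn_ile1; lra.
  by move: IH; rewrite exprS; move: (_ ^+ k) => h; lra.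
rewrite (exprS _ k.+1); set h := _ ^+ k.+1 in IH *.
apply/andP; split; first by nra.
by nra.
Qed.

(** The factors 1 + e/2 have a convergent product: the bound 2 - 2^-k leaves
    room for the next factor, at most 1 + 2^-(k+2). *)
Lemma rsqrt_newton_half (R : realFieldType) k :
  0 <= (rsqrt_newton R k).[2^-1] <= 2 - 2^-1 ^+ k.
Proof.
elim: k => [|k /andP[a0 IH]] /=.
  by rewrite hornerC expr0 ler01; lra.
have /andP[e0] := rsqrt_residue_half R k.
rewrite !hornerE /= exprS; move: (rsqrt_newton R k).[_] a0 IH => a a0 IH.
move: (_.[_]) e0 => e e0.
have : 0 < (2^-1 : R) ^+ k by rewrite exprn_gt0 // invr_gt0.
move: (_ ^+ k) IH => h IH h0 eh.
apply/andP; split; first by nra.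
have : a * (1 + 2^-1 * e) <= (2 - h) * (1 + 2^-1 * (2^-1 * h)).
  by apply: ler_pM => //; lra.
by nra.
Qed.

Lemma rsqrt_newton_gt0 (R : realFieldType) k (x : R) :
  `|x| <= 2^-1 -> 0 < (rsqrt_newton R k).[x].
Proof.
move=> x2; elim: k => [|k IH] /=; first by rewrite hornerC.
rewrite hornerM mulr_gt0 // hornerD hornerC hornerZ.
have := normr_horner_nneg_le (rsqrt_residue_ge0 R k) x2.
have /andP[_] := rsqrt_residue_half R k.
have : (2^-1 : R) ^+ k.+1 <= 1 by apply: exprn_ile1; lra.
by rewrite ler_norml => ? ? /andP[? ?]; lra.
Qed.

Lemma normr_exprB1_le (R : realDomainType) (m : R) j :
  `|m| <= 2 -> `|m ^+ j - 1| <= (2 ^+ j - 1) * `|m - 1|.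
Proof.
move=> m2; elim: j => [|j IH]; first by rewrite !expr0 subrr normr0 mul0r.
have -> : m ^+ j.+1 - 1 = m * (m ^+ j - 1) + (m - 1) by rewrite exprS; ring.
rewrite (le_trans (ler_normD _ _)) // normrM.
have : `|m| * `|m ^+ j - 1| <= 2 * ((2 ^+ j - 1) * `|m - 1|) by rewrite ler_pM.
rewrite exprS; lra.
Qed.

(** * Expansion of a Legendre polynomial of z / r for nearly constant r *)

(** Let s = c (1-q), with |q| <= 1/256, and let a be a polynomial close to
    (1-X)^(-1/2). Then (z / sqrt s)^j is close to (z / sqrt c)^j a(q)^j.
    Truncating a^j at degree n costs (2 |q|)^n a(1/2)^j <= 128^-n 2^j, and
    the coefficients of P_n and (z / sqrt c)^j contribute at most 4^n 2^n.
    The index 6n for the iteration makes the distance from a to the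
    inverse square root equally harmless; it does not affect the degree of
    the result. *)
Lemma legendre_local_approx (R : realType) n (c : R) : 0 < c ->
  exists2 H : nat -> {poly R}, forall j, (size (H j) <= n.+1)%N &
    forall s z, `|s - c| <= c / 256 -> z ^+ 2 <= s ->
      `|(@legendre R n).[z / Num.sqrt s] - \sum_(j < n.+1) z ^+ j * (H j).[s]|
      <= 2 / 4 ^+ n.
Proof.
move=> c0; set p := legendre n.
have sc0 : 0 < Num.sqrt c by rewrite sqrtr_gt0.
pose a := rsqrt_newton R (6 * n).
pose T j := take_poly n (a ^+ j).
exists (fun j => (p`_j / Num.sqrt c ^+ j) *: (T j \Po (1 - c^-1 *: 'X))).
  move=> j; rewrite (leq_trans (size_scale_leq _ _)) //.
  rewrite (leq_trans (size_comp_poly_leq _ _)) //.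
  have sq : ((size (1 - c^-1 *: 'X : {poly R})%R).-1 <= 1)%N.
    rewrite -subn1 leq_subLR (leq_trans (size_polyD _ _)) // size_polyN geq_max.
    rewrite size_poly1 (leq_trans (size_scale_leq _ _)) // size_polyX //.
  rewrite ltnS (leq_trans (leq_mul (leqnn _) sq)) // muln1.
  by rewrite (leq_trans (leq_pred _)) // size_take_poly.
move=> s z sc zs; pose q := 1 - s / c.
have q_small : `|q| <= 256^-1.
  have -> : q = - (s - c) / c by rewrite /q; field; rewrite gt_eqF.
  by rewrite mulNr normrN normrM (gtr0_norm (_ : 0 < c^-1)) ?invr_gt0 //
    ler_pdivrMr // mulrC.
have q2 : `|q| <= 2^-1 by rewrite (le_trans q_small) //; lra.
have s_gt0 : 0 < s by move: sc; rewrite ler_norml => /andP[]; lra.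
have ss0 : 0 < Num.sqrt s by rewrite sqrtr_gt0.
pose t := z / Num.sqrt s; pose rho := Num.sqrt s / Num.sqrt c.
have t1 : `|t| <= 1.
  rewrite -(@ler_pXn2r _ 2) ?nnegrE // -normrX expr1n ger0_norm ?sqr_ge0 //.
  by rewrite expr_div_n sqr_sqrtr ?(ltW s_gt0) // ler_pdivrMr // mul1r.
have rho2 : rho ^+ 2 = 1 - q.
  by rewrite expr_div_n !sqr_sqrtr ?ltW // /q opprB addrC subrK.
have rho_gt0 : 0 < rho by rewrite divr_gt0.
have rho_le2 : rho <= 2.
  rewrite -(@ler_pXn2r _ 2) ?nnegrE ?ltW // rho2.
  by move: q2; rewrite ler_norml => /andP[? ?]; lra.
have zE : z / Num.sqrt c = t * rho.
  by rewrite /t /rho; field; rewrite !gt_eqF.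
(* m = a(q) (1 - q)^(1/2) measures how far a is from the inverse square root *)
pose m := a.[q] * rho.
have am0 : 0 < a.[q] by exact: rsqrt_newton_gt0.
have m_close : `|m - 1| <= 2^-1 ^+ (6 * n).+1.
  have m0 : 0 < m by rewrite mulr_gt0.
  have mE : m ^+ 2 - 1 = - (rsqrt_residue R (6 * n)).[q].
    have := congr1 (horner^~ q) (rsqrt_newtonE R (6 * n)).
    rewrite !(hornerD, hornerN, hornerM, horner_exp, hornerX, hornerC) => E.
    by rewrite /m exprMn rho2 mulrC E; ring.
  have /andP[_] := rsqrt_residue_half R (6 * n).
  apply: le_trans; rewrite (le_trans _ (normr_horner_nneg_le (rsqrt_residue_ge0
    R _) q2)) //.
  rewrite -[X in _ <= X]normrN -mE (_ : m ^+ 2 - 1 = (m - 1) * (m + 1));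
    last by ring.
  by rewrite normrM ler_peMr // ger0_norm; lra.
have m_le2 : `|m| <= 2.
  have : (2^-1 : R) ^+ (6 * n).+1 <= 1 by apply: exprn_ile1; lra.
  move: m_close; rewrite ler_norml ler_norml => /andP[? ?] ?; apply/andP;
    split; lra.
have term_close (j : 'I_n.+1) :
  `|p`_j * t ^+ j - z ^+ j * ((p`_j / Num.sqrt c ^+ j)
    *: (T j \Po (1 - c^-1 *: 'X))).[s]|
  <= 4 ^+ n * (2 ^+ n * 2^-1 ^+ (6 * n).+1 + 2 ^+ n * (2 ^+ n * 128^-1 ^+ n)).
  have jn : (j <= n)%N by rewrite -ltnS.
  have -> : z ^+ j * ((p`_j / Num.sqrt c ^+ j)
    *: (T j \Po (1 - c^-1 *: 'X))).[s]
    = p`_j * ((t * rho) ^+ j * (T j).[q]).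
    rewrite -zE hornerZ horner_comp !hornerE /= (mulrC c^-1) -/q expr_div_n.
    by ring.
  rewrite -mulrBr normrM ler_pM ?normr_coef_legendre_le //.
  have -> : t ^+ j - (t * rho) ^+ j * (T j).[q] =
     t ^+ j * (- (m ^+ j - 1)) + (t * rho) ^+ j * ((a ^+ j).[q] - (T j).[q]).
    by rewrite horner_exp /m !exprMn; ring.
  have le2X (x : R) : `|x| <= 2 -> `|x| ^+ j <= 2 ^+ n.
    move=> x2; apply: (@le_trans _ _ (2 ^+ j));
      first by rewrite lerXn2r ?nnegrE.
    by rewrite ler_weXn2l //; lra.
  rewrite (le_trans (ler_normD _ _)) // lerD //.
    rewrite normrM normrN normrX -[leRHS]mul1r ler_pM ?exprn_ge0 ?exprn_ile1 //.
    rewrite (le_trans (normr_exprB1_le _ m_le2)) // ler_pM //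
      ?subr_ge0 ?exprn_ege1 //; first lra.
    have : (2 : R) ^+ j <= 2 ^+ n by rewrite ler_weXn2l //; lra.
    by lra.
  rewrite normrM normrX ler_pM ?exprn_ge0 //.
    by rewrite le2X // normrM -[leRHS]mul1r ler_pM // gtr0_norm.
  rewrite (le_trans (horner_nneg_tail_le n (coef_ge0X j (rsqrt_newton_ge0 R _))
    _ q2)) ?invr_gt0 //.
  rewrite mulrC ler_pM ?exprn_ge0 //.
  - by rewrite horner_exp exprn_ge0 //;
    case/andP: (rsqrt_newton_half R (6 * n)).
  - by rewrite horner_exp -[_.[_]]ger0_norm ?le2X //;
      case/andP: (rsqrt_newton_half R (6 * n)) => h0 h1 //;
      rewrite ger0_norm // (le_trans h1) // gerBl exprn_ge0 // invr_ge0.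
  - rewrite lerXn2r ?nnegrE ?divr_ge0 ?invr_ge0 //.
    by rewrite invrK; lra.
rewrite (horner_coef_wide _ (size_legendre R n)) -/p -sumrB.
apply: le_trans (ler_norm_sum _ _ _) _.
apply: le_trans (ler_sum _ (fun j _ => term_close j)) _.
rewrite sumr_const card_ord.
have nA : n.+1%:R <= 2 ^+ n :> R by rewrite -natrX ler_nat ltn_expl.
have A0 : 0 < 2 ^+ n :> R by rewrite exprn_gt0.
have -> : 4 ^+ n = (2 ^+ n) ^+ 2 :> R by rewrite -!exprM mulnC exprM;
  congr (_ ^+ n); lra.
have -> : 128^-1 ^+ n = (2 ^+ n) ^- 7 :> R.
  by rewrite exprVn; congr _^-1; rewrite -!exprM mulnC exprM; congr (_ ^+ n);
    lra.
have -> : 2^-1 ^+ (6 * n).+1 = 2^-1 * (2 ^+ n) ^- 6 :> R.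
  by rewrite exprS exprVn mulnC exprM.
move: (2 ^+ n) nA A0 => A nA A0.
rewrite -[X in X <= _]mulr_natr.
(* everything is now a power of A = 2^n, and n + 1 <= A *)
apply: (@le_trans _ _ (A ^+ 2 * (A * (2^-1 / A ^+ 6) + A * (A / A ^+ 7)) * A)).
  by rewrite ler_wpM2l // mulr_ge0 ?addr_ge0 ?mulr_ge0 ?invr_ge0 ?exprn_ge0 //
    ltW.
rewrite (_ : _ * _ * A = 3 / 2 / A ^+ 2); last by field; rewrite gt_eqF.
by rewrite ler_pM2r ?invr_gt0 ?exprn_gt0 //; lra.
Qed.

(** * Separated kernels *)

Definition monomial3 (R : realType) L (a : 'I_L * 'I_L * 'I_L)
    (x : space3 R) : R :=
  x.1.1 ^+ a.1.1 * x.1.2 ^+ a.1.2 * x.2 ^+ a.2.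

(** A sum of L^3 products, whose first factors are the monomials of degree
    less than L in each variable. Fixing these first factors makes such
    kernels a vector space, so that sums do not increase the number of
    products. *)
Definition separated (R : realType) L (h : space3 R -> space3 R -> R) :=
  exists2 g : 'I_L * 'I_L * 'I_L -> space3 R -> R,
    (forall a, continuous (g a)) &
    forall x y, h x y = \sum_a monomial3 a x * g a y.

Section Separated.
Context (R : realType) (L : nat).
Implicit Types h : space3 R -> space3 R -> R.

Lemma eq_separated h1 h2 : (forall x y, h1 x y = h2 x y) -> separated L h1 ->
  separated L h2.
Proof. by move=> e [g gc gE]; exists g => // x y; rewrite -e gE. Qed.

Lemma separated0 : separated L (fun _ _ => 0 : R).
Proof.
exists (fun _ _ => 0) => [a x|x y]; first exact: cvg_cst.
by rewrite big1 // => a _; rewrite mulr0.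
Qed.

Lemma separatedD h1 h2 : separated L h1 -> separated L h2 ->
  separated L (fun x y => h1 x y + h2 x y).
Proof.
move=> [g1 c1 e1] [g2 c2 e2]; exists (fun a x => g1 a x + g2 a x) => [a x|x y].
  by apply: continuousD; [exact: c1 | exact: c2].
by rewrite e1 e2 -big_split; apply: eq_bigr => a _; rewrite mulrDr.
Qed.

Lemma separatedZ (c : R) h :
  separated L h -> separated L (fun x y => c * h x y).
Proof.
move=> [g gc e]; exists (fun a x => c * g a x) => [a x|x y].
  by apply: continuousM; [exact: cvg_cst | exact: gc].
by rewrite e mulr_sumr; apply: eq_bigr => a _; rewrite mulrCA.
Qed.

Lemma separated_sum n (h : nat -> space3 R -> space3 R -> R) :
  (forall i, (i < n)%N -> separated L (h i)) ->
  separated L (fun x y => \sum_(i < n) h i x y).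
Proof.
elim: n => [|n IH] sh.
  by apply: eq_separated separated0 => x y; rewrite big_ord0.
have /eq_separated : separated L (fun x y => \sum_(i < n) h i x y + h n x y).
  by apply: separatedD; [apply: IH => i ni; apply: sh; exact: ltnW | exact: sh].
by apply => x y; rewrite big_ord_recr.
Qed.

Lemma subr_expr_sum (s t : R) a : (a < L)%N ->
  (s - t) ^+ a = \sum_(i < L) s ^+ i * ((- t) ^+ (a - i) *+ 'C(a, i)).
Proof.
move=> aL; rewrite addrC exprDn (big_ord_widen L
  (fun i => ((- t) ^+ (a - i) * s ^+ i) *+ 'C(a, i))) // big_mkcond.
apply: eq_bigr => i _; case: ltnP => [_|ai]; first by rewrite mulrnAr mulrC.
by rewrite bin_small // mulr0n mulr0.
Qed.

Lemma separated_monomial a b c : (a < L)%N -> (b < L)%N -> (c < L)%N ->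
  separated L (fun x y : space3 R => (x.1.1 - y.1.1) ^+ a
    * (x.1.2 - y.1.2) ^+ b * (x.2 - y.2) ^+ c).
Proof.
move=> aL bL cL; pose G d (i : nat) (t : R) : R := (- t) ^+ (d - i) *+ 'C(d, i).
have Gc d i : continuous (G d i).
  rewrite (_ : G d i = horner ((- 'X) ^+ (d - i) *+ 'C(d, i))).
    exact: continuous_horner.
  by apply/funext => t; rewrite hornerMn horner_exp hornerN hornerX.
exists (fun (i : 'I_L * 'I_L * 'I_L) y =>
  G a i.1.1 y.1.1 * G b i.1.2 y.1.2 * G c i.2 y.2) => [i y|x y].
  rewrite /=; apply: (@continuousM R _
    (fun y => G a i.1.1 y.1.1 * G b i.1.2 y.1.2) (fun y => G c i.2 y.2));
    first apply: (@continuousM R _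
      (fun y => G a i.1.1 y.1.1) (fun y => G b i.1.2 y.1.2)).
  - apply: (@continuous_comp _ _ _ (fst \o fst)); last exact: Gc.
    by apply: continuous_comp; exact: cvg_fst.
  - apply: (@continuous_comp _ _ _ (snd \o fst)); last exact: Gc.
    by apply: continuous_comp; [exact: cvg_fst | exact: cvg_snd].
  - by apply: continuous_comp; [exact: cvg_snd | exact: Gc].
rewrite !subr_expr_sum // big_distrlr pair_bigA big_distrlr pair_bigA /=.
by apply: eq_bigr => i _; rewrite /monomial3 /G; ring.
Qed.

End Separated.

Definition sqdist (R : realType) (x y : space3 R) : R :=
  (x.1.1 - y.1.1) ^+ 2 + (x.1.2 - y.1.2) ^+ 2 + (x.2 - y.2) ^+ 2.

(** Two binomial expansions of (u^2 + v^2 + w^2)^m give monomials in x-y of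
    degree at most 2n in u and v, and 2n + j <= 3n in w. *)
Lemma separated_horner_sqdist (R : realType) n j (H : {poly R}) :
  (j <= n)%N -> (size H <= n.+1)%N ->
  separated (3 * n).+1
    (fun x y : space3 R => (x.2 - y.2) ^+ j * H.[sqdist x y]).
Proof.
move=> jn Hn.
pose M m i k (x y : space3 R) := (x.1.1 - y.1.1) ^+ (2 * (m - i - k))
  * (x.1.2 - y.1.2) ^+ (2 * k) * (x.2 - y.2) ^+ (2 * i + j).
suff : separated (3 * n).+1 (fun x y => \sum_(m < n.+1) \sum_(i < m.+1)
    \sum_(k < (m - i).+1) (H`_m * 'C(m, i)%:R * 'C(m - i, k)%:R) * M m i k x y).
  apply: eq_separated => x y; rewrite (horner_coef_wide _ Hn) mulr_sumr.
  rewrite /sqdist /M; move: (x.1.1 - _) (x.1.2 - _) (x.2 - _) => u v w.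
  apply: eq_bigr => m _; rewrite (exprDn (u ^+ 2 + v ^+ 2)) !mulr_sumr.
  apply: eq_bigr => i _; rewrite (exprDn (u ^+ 2))
    mulr_suml -sumrMnl !mulr_sumr.
  apply: eq_bigr => k _; rewrite exprD !exprM; ring.
pose T m i k x y : R := (H`_m * 'C(m, i)%:R * 'C(m - i, k)%:R) * M m i k x y.
apply: (@separated_sum _ _ n.+1
  (fun m x y => \sum_(i < m.+1) \sum_(k < (m - i).+1) T m i k x y)) => m mn.
apply: (@separated_sum _ _ m.+1
  (fun i x y => \sum_(k < (m - i).+1) T m i k x y)) => i im.
apply: (@separated_sum _ _ (m - i).+1 (T m i)) => k km.
by apply: separatedZ; apply: separated_monomial; lia.
Qed.

(** * Essential bounds and measurability in space *)

Lemma Linfty_norm2_le (R : realType) (A B : set (space3 R))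
    (h : space3 R -> space3 R -> R) (e : R) : 0 <= e ->
  (forall x y, A x -> B y -> `|h x y| <= e) -> (Linfty_norm2 A B h <= e%:E)%E.
Proof.
move=> e0 he; rewrite /Linfty_norm2 unlock; case: ifPn => // _.
apply/ess_supP/nearW => -[x y] /=; rewrite patchE lee_fin.
by case: ifPn => [/set_mem [/= Ax By]|_]; [exact: he | rewrite normr0].
Qed.

Lemma Linfty_bounded (R : realType) (A : set (space3 R))
    (f : space3 R -> R) (M : R) :
  measurable (A : set (mspace3 R)) ->
  measurable_fun [set: mspace3 R] (f : mspace3 R -> R) ->
  (forall x, A x -> `|f x| <= M) -> Linfty A f.
Proof.
move=> mA mf fM; rewrite /Linfty inE; apply/andP; split; rewrite inE /=.
  by have /(measurable_restrictT _ mA).1 := @measurable_funTS _ _ _ _ A _ mf.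
rewrite /finite_norm unlock; case: ifPn => // _.
apply: (@le_lt_trans _ _ (Num.max 0 M)%:E); last exact: ltry.
apply/ess_supP/nearW => x /=; rewrite patchE lee_fin le_max.
by case: ifPn => [/set_mem Ax|_]; [rewrite fM ?orbT | rewrite normr0 lexx].
Qed.

(** The sigma-algebra on space is the product one, so an open set must be
    written as a countable union of boxes, here with rational centres and
    sides 2/(n+1). *)
Lemma open_measurable3 (R : realType) (U : set (space3 R)) :
  open U -> measurable (U : set (mspace3 R)).
Proof.
move=> oU.
pose box (i : rat * rat * rat * nat) : set (mspace3 R) :=
  (ball (ratr i.1.1.1 : R) (i.2.+1%:R^-1 : R)
   `*` ball (ratr i.1.1.2 : R) (i.2.+1%:R^-1 : R))
   `*` ball (ratr i.1.2 : R) (i.2.+1%:R^-1 : R).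
have -> : U = \bigcup_(i in [set i | box i `<=` U]) box i.
  apply/seteqP; split => [x Ux|x [i /= iU] /iU //].
  have /nbhs_ballP [e /= e0 xeU] : nbhs x U by exact: open_nbhs_nbhs.
  have [n n_e] : exists n, n.+1%:R^-1 < e / 2.
    exists (Num.truncn (e / 2)^-1).
    by rewrite invf_plt ?posrE ?divr_gt0 // truncnS_gt.
  have nV0 : 0 < n.+1%:R^-1 :> R by rewrite invr_gt0.
  have near_rat (t : R) : exists q : rat, `|ratr q - t| < n.+1%:R^-1.
    move: (n.+1%:R^-1) nV0 => d d0.
    have [|q] := @rat_in_itvoo R (t - d) (t + d); first lra.
    by rewrite in_itv /= => /andP[? ?]; exists q; rewrite ltr_norml; lra.
  have [q1 h1] := near_rat x.1.1; have [q2 h2] := near_rat x.1.2.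
  have [q3 h3] := near_rat x.2.
  exists (q1, q2, q3, n) => /=; last by split; [split|].
  move=> y [[/= y1 y2] y3]; apply: xeU.
  have tri (q s t : R) : `|q - s| < n.+1%:R^-1 ->
      ball q (n.+1%:R^-1) t -> ball s e t.
    rewrite -!ball_normE /= => qs qt.
    have -> : s - t = (q - t) - (q - s) by ring.
    rewrite (le_lt_trans (ler_normB _ _)) //.
    by move: qs qt n_e; move: (n.+1%:R^-1) => d; lra.
  by split; [split|]; [exact: tri y1 | exact: tri y2 | exact: tri y3].
rewrite bigcup_mkcond; apply: countable_bigcupT_measurable => // i.
case: ifP => // _; apply: measurableX; last exact: measurable_ball.
by apply: measurableX; exact: measurable_ball.
Qed.

Lemma continuous_measurable3 (R : realType) (f : space3 R -> R) :
  continuous f -> measurable_fun [set: mspace3 R] (f : mspace3 R -> R).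
Proof.
move=> /continuousP cf.
apply: (measurability _ (RGenOInfty.measurableE R)) => //.
move=> _ [_ [r ->] <-]; rewrite setTI.
by apply: open_measurable3; apply: cf; exact: interval_open.
Qed.

Lemma compact_measurable3 (R : realType) (A : set (space3 R)) :
  compact A -> measurable (A : set (mspace3 R)).
Proof.
move=> /compact_closed => /(_ (@norm_hausdorff _ _)) cA.
rewrite -[A]setCK; apply: measurableC; apply: open_measurable3.
exact: closed_openC.
Qed.

Lemma compact_continuous_bounded (R : realType) (A : set (space3 R))
    (f : space3 R -> R) :
  compact A -> continuous f -> exists M, forall x, A x -> `|f x| <= M.
Proof.
move=> cA cf; have := continuous_compact (continuous_subspaceT cf) cA.
move=> /compact_bounded [M [_ hM]]; exists (M + 1) => x Ax.
by apply: (hM (M + 1)); [rewrite ltrDl | exists x].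
Qed.

(** * Partition into small cells *)

(** Slabs of width h in each coordinate, closed on the left only so as not to
    overlap, and enough of them to cover the cube of half-side M. *)
Lemma bounded_grid (R : realType) (M h : R) : 0 < h ->
  exists (K : nat) (B : 'I_K * 'I_K * 'I_K -> set (space3 R)),
  [/\ forall i, measurable (B i : set (mspace3 R)),
      forall i x x', B i x -> B i x' -> ball x h x' &
      forall x, `|x.1.1| <= M -> `|x.1.2| <= M -> `|x.2| <= M ->
        exists i, forall j, B j x <-> j = i].
Proof.
move=> h0; pose K := (Num.truncn ((M + M) / h)).+1.
pose slab (i : nat) : set R := `[i%:R * h - M, i.+1%:R * h - M[%classic.
have slab_close i s t : slab i s -> slab i t -> ball s h t.
  rewrite /slab /= !in_itv /= -natr1 mulrDl mul1r => /andP[s1 s2] /andP[t1 t2].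
  rewrite -ball_normE /= ltr_norml; move: (i%:R * h) s1 s2 t1 t2 => a *; lra.
have slabP t : `|t| <= M ->
    exists i : 'I_K, forall j : 'I_K, slab j t <-> j = i.
  rewrite ler_norml => /andP[tM1 tM2].
  have t0 : 0 <= (t + M) / h by rewrite divr_ge0 ?(ltW h0) //; lra.
  have iK : (Num.truncn ((t + M) / h) < K)%N.
    have tM : (t + M) / h <= (M + M) / h by rewrite ler_pM2r ?invr_gt0 //
      lerD2r.
    rewrite ltnS truncn_ge_nat ?(le_trans t0) //.
    by case/andP: (truncn_itv t0) => /le_trans + _; apply.
  exists (Ordinal iK) => j.
  have -> : slab j t <-> j%:R <= (t + M) / h < j.+1%:R.
    by rewrite /slab /= in_itv /= ler_pdivlMr // ltr_pdivrMr // lerBlDr ltrBrDr.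
  rewrite -truncn_eq //; split => [/eqP e|->//]; exact/val_inj.
exists K, (fun i : 'I_K * 'I_K * 'I_K => (slab i.1.1 `*` slab i.1.2)
  `*` slab i.2); split.
- by move=> i; apply: measurableX; [apply: measurableX|]; exact: measurable_itv.
- move=> i x x' [[x1 x2] x3] [[y1 y2] y3].
  by split; [split|]; [exact: slab_close y1|exact: slab_close y2|exact:
    slab_close y3].
- move=> x /slabP [i1 h1] /slabP [i2 h2] /slabP [i3 h3].
  exists (i1, i2, i3) => -[[j1 j2] j3];
    split => [[[/= /h1 -> /h2 ->] /h3 ->]//|].
  by case=> /h1 ? /h2 ? /h3 ?.
Qed.

(** * Averages along segments *)

(** The theorem of Heine and Cantor, for a function continuous on K only. *)
Lemma compact_within_uniform (R : realType) (K : set (space3 R))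
    (f : space3 R -> R) :
  compact K -> {within K, continuous f} -> forall e, 0 < e ->
  exists2 h, 0 < h &
    forall u v, K u -> K v -> ball u h v -> `|f u - f v| < e.
Proof.
move=> cK /subspace_continuousP cf e e0.
move/compact_near_coveringP/near_covering_withinP : cK.
move=> /(_ R (0^'+) (fun h u =>
  forall v, K v -> ball u h v -> `|f u - f v| < e)).
case.
  move=> x Kx.
  have e20 : 0 < e / 2 by rewrite divr_gt0.
  have /cvgrPdist_lt /(_ _ e20) := cf x Kx.
  rewrite near_withinE => /nbhs_ballP [r /= r0 xr].
  exists (ball x (r / 2), [set h | h < r / 2]); first split.
  - by apply: nbhsx_ballx; rewrite divr_gt0.
  - by apply: nbhs_right_lt; rewrite divr_gt0.
  - move=> [u h] [/= xu hr] Ku v Kv uv.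
    have xv : ball x r v.
      rewrite (splitr r); apply: ball_triangle xu _.
      by apply: le_ball uv; exact: ltW.
    have xu' : ball x r u by apply: le_ball xu; lra.
    have := xr _ xu' Ku; have := xr _ xv Kv; rewrite /= => h1 h2.
    have -> : f u - f v = (f x - f v) - (f x - f u) by ring.
    by rewrite (le_lt_trans (ler_normB _ _)) //; lra.
move=> h [h0 H].
exists (h / 2); first by rewrite divr_gt0.
move=> u v Ku Kv; apply: (H (h / 2)) => //; last by rewrite divr_gt0.
by rewrite /ball_ /= sub0r normrN gtr0_norm ?divr_gt0 //; move: h0 => /=; lra.
Qed.

Definition segment_point (R : realType) (x y : space3 R) (s : R) : space3 R :=
  x + s *: (y - x).

Lemma segment_point_convex (R : realType) (A : set (space3 R)) x y s :
  convex_set A -> A x -> A y -> 0 <= s <= 1 -> A (segment_point x y s).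
Proof.
move=> cA Ax Ay /andP[s0 s1].
have := cA y x (Itv01 s0 s1) (mem_set Ay) (mem_set Ax).
rewrite inE.
suff -> : segment_point x y s = s *: y + (1 - s) *: x by [].
rewrite /segment_point scalerBr scalerBl scale1r addrC -!addrA.
by rewrite [- _ + _]addrC.
Qed.

Lemma segment_point_close (R : realType) (x y x' y' : space3 R) h s :
  0 <= s <= 1 -> ball x h x' -> ball y h y' ->
  ball (segment_point x y s) h (segment_point x' y' s).
Proof.
move=> /andP[s0 s1].
have conv (a b a' b' : R) : ball a h a' -> ball b h b' ->
    ball (a + s * (b - a)) h (a' + s * (b' - a')).
  rewrite -!ball_normE /= => aa bb.
  have -> : a + s * (b - a) - (a' + s * (b' - a')) =
      (1 - s) * (a - a') + s * (b - b').
    by ring.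
  rewrite (le_lt_trans (ler_normD _ _)) // !normrM (ger0_norm s0).
  rewrite (ger0_norm (_ : 0 <= 1 - s)) ?subr_ge0 //.
  have [->|sn0] := eqVneq s 0; first by rewrite subr0 mul1r mul0r addr0.
  have : s * `|b - b'| < s * h by rewrite ltr_pM2l // lt_neqAle eq_sym sn0.
  have : (1 - s) * `|a - a'| <= (1 - s) * h by rewrite ler_wpM2l ?subr_ge0 //
    ltW.
  by lra.
by move=> [[x1 x2] x3] [[y1 y2] y3]; split; [split|]; exact: conv.
Qed.

Lemma segment_point_continuous (R : realType) (x y : space3 R) :
  continuous (segment_point x y).
Proof.
move=> s; apply: cvgD; first exact: cvg_cst.
by apply: cvgZl; exact: cvg_id.
Qed.

(** The integral in the attenuation factor. *)
Definition path_mean (R : realType) (f : space3 R -> R) (x y : space3 R) : R :=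
  \int[lebesgue_measure]_(s in `[0, 1]) f (segment_point x y s).

Section PathMean.
Context (R : realType) (Omega : set (space3 R)) (f : space3 R -> R).
Context (cK : compact (closure Omega))
  (fK : {within closure Omega, continuous f}).
Context (convO : convex_set Omega).

Let point_closure x y s : Omega x -> Omega y -> `[0, 1]%classic s ->
  closure Omega (segment_point x y s).
Proof.
move=> Ox Oy; rewrite /= in_itv /= => s01; apply: subset_closure.
exact: segment_point_convex.
Qed.

Lemma path_integrable x y : Omega x -> Omega y ->
  (@lebesgue_measure R).-integrable `[0, 1]
    (EFin \o (fun s => f (segment_point x y s))).
Proof.
move=> Ox Oy; apply: continuous_compact_integrable;
  first exact: segment_compact.
apply/subspace_continuousP => s s01; apply/cvgrPdist_lt => e e0.
have [h h0 H] := compact_within_uniform cK fK e0.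
have /cvg_ball /(_ _ h0) := @segment_point_continuous R x y s.
rewrite near_withinE; apply: filterS => t st t01.
by apply: H => //; exact: point_closure.
Qed.

Lemma path_mean_dist x y x' y' e : Omega x -> Omega y -> Omega x' -> Omega y' ->
  (forall s, 0 <= s <= 1 ->
    `|f (segment_point x y s) - f (segment_point x' y' s)| <= e) ->
  `|path_mean f x y - path_mean f x' y'| <= e.
Proof.
move=> Ox Oy Ox' Oy' fe.
have i1 := path_integrable Ox Oy; have i2 := path_integrable Ox' Oy'.
have m01 : measurable (`[0, 1]%classic : set (measurableTypeR R))
  by exact: measurable_itv.
have ie : (@lebesgue_measure R).-integrable `[0, 1] (EFin \o (fun=> e)).
  apply: continuous_compact_integrable; first exact: segment_compact.
  by apply: continuous_subspaceT => s; exact: cvg_cst.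
have id : (@lebesgue_measure R).-integrable `[0, 1]
    (EFin \o (fun s => f (segment_point x y s) - f (segment_point x' y' s))).
  by have := integrableB m01 i1 i2.
rewrite /path_mean -RintegralB // (le_trans (le_normr_Rintegral m01 id)) //.
apply: (@le_trans _ _ (\int[lebesgue_measure]_(s in `[0%R, 1%R]) e)).
  apply: le_Rintegral => //; first by have := integrable_abse id.
by rewrite (Rintegral_cst _ m01)
  /= lebesgue_measure_itv /= lte_fin ltr01 /= oppr0 addr0 mulr1.
Qed.

Lemma path_mean_bounds (b : R) x y : Omega x -> Omega y ->
  (forall z, closure Omega z -> 0 <= f z <= b) -> 0 <= path_mean f x y <= b.
Proof.
move=> Ox Oy fb; apply/andP; split.
  apply: Rintegral_ge0 => s s01.
  by have /andP[] := fb _ (point_closure Ox Oy s01).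
have m01 : measurable (`[0, 1]%classic : set (measurableTypeR R))
  by exact: measurable_itv.
have ib : (@lebesgue_measure R).-integrable `[0, 1] (EFin \o (fun=> b)).
  apply: continuous_compact_integrable; first exact: segment_compact.
  by apply: continuous_subspaceT => s; exact: cvg_cst.
apply: (@le_trans _ _ (\int[lebesgue_measure]_(s in `[0%R, 1%R]) b)).
  apply: le_Rintegral => //; first exact: path_integrable.
  by move=> s s01; have /andP[] := fb _ (point_closure Ox Oy s01).
by rewrite (Rintegral_cst _ m01)
  /= lebesgue_measure_itv /= lte_fin ltr01 /= oppr0 addr0 mulr1.
Qed.

End PathMean.

(** * Uniform continuity of the attenuation factor *)

Lemma expRN_lipschitz (R : realType) (a b : R) : 0 <= a -> 0 <= b ->
  `|expR (- a) - expR (- b)| <= `|a - b|.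
Proof.
wlog ab : a b / a <= b => [H a0 b0|a0 b0].
  have [/H|/ltW/H] := leP a b; first exact.
  by rewrite distrC (distrC a); exact.
rewrite ger0_norm ?subr_ge0 ?ler_expR ?lerN2 // distrC ger0_norm ?subr_ge0 //.
have -> : expR (- b) = expR (- a) * expR (- (b - a)).
  by rewrite -expRD; congr expR; ring.
have e1 : expR (- a) <= 1 by rewrite expR_le1 oppr_le0.
have e0 : 0 < expR (- a) by exact: expR_gt0.
have := expR_ge1Dx (- (b - a)).
move: (expR (- a)) (expR _) e1 e0 => e f e1 e0 h.
by rewrite -[X in X - _]mulr1 -mulrBr; nra.
Qed.

Lemma sqrt_lipschitz (R : realType) (D s t : R) : 0 < D -> D <= s -> D <= t ->
  `|Num.sqrt s - Num.sqrt t| <= `|s - t| / Num.sqrt D.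
Proof.
move=> D0 Ds Dt; have sD : 0 < Num.sqrt D by rewrite sqrtr_gt0.
have -> : s - t = (Num.sqrt s - Num.sqrt t) * (Num.sqrt s + Num.sqrt t).
  by rewrite -subr_sqr !sqr_sqrtr // ltW // (lt_le_trans D0).
rewrite normrM ler_pdivlMr //.
rewrite ler_wpM2l // ger0_norm ?addr_ge0 ?sqrtr_ge0 //.
by rewrite (le_trans (ler_wsqrtr Ds)) // lerDl sqrtr_ge0.
Qed.

(** With s = r^2 and b the mean of the coefficient along the segment, the
    factor E / r^2 is exp(-r b) / r^2, which is Lipschitz in (s, b) away
    from s = 0. *)
Lemma attenuated_lipschitz (R : realType) (D Q S : R) :
  0 < D -> 0 <= Q -> 0 <= S ->
  exists A B : R, [/\ 0 <= A, 0 <= B & forall s s' b b',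
    D <= s <= Q -> D <= s' <= Q -> 0 <= b <= S -> 0 <= b' <= S ->
    `|expR (- Num.sqrt s * b) / s - expR (- Num.sqrt s' * b') / s'|
      <= A * `|b - b'| + B * `|s - s'|].
Proof.
move=> D0 Q0 S0; have sD : 0 < Num.sqrt D by rewrite sqrtr_gt0.
exists (Num.sqrt Q / D), (S / Num.sqrt D / D + D ^- 2); split.
- by rewrite divr_ge0 ?sqrtr_ge0 // ltW.
- by rewrite addr_ge0 ?invr_ge0 ?exprn_ge0 ?divr_ge0 // ltW.
move=> s s' b b' /andP[Ds sQ] /andP[Ds' sQ'] /andP[b0 bS] /andP[b0' bS'].
have s0 : 0 < s by exact: lt_le_trans Ds.
have s0' : 0 < s' by exact: lt_le_trans Ds'.
have e1 : expR (- (Num.sqrt s' * b')) <= 1.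
  by rewrite expR_le1 oppr_le0 mulr_ge0 ?sqrtr_ge0.
rewrite !mulNr; set e := expR _; set e' := expR _ in e1 *.
have -> : e / s - e' / s' = (e - e') / s + e' * ((s' - s) / (s * s')).
  by field; rewrite !gt_eqF.
rewrite (le_trans (ler_normD _ _)) //.
have ee : `|e - e'| <= Num.sqrt Q * `|b - b'| + S * (`|s - s'| / Num.sqrt D).
  rewrite (le_trans (expRN_lipschitz _ _)) ?mulr_ge0 ?sqrtr_ge0 //.
  have -> : Num.sqrt s * b - Num.sqrt s' * b' =
    Num.sqrt s * (b - b') + b' * (Num.sqrt s - Num.sqrt s') by ring.
  rewrite (le_trans (ler_normD _ _)) // !normrM lerD //.
    by rewrite ler_wpM2r // ger0_norm ?sqrtr_ge0 // ler_wsqrtr.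
  by rewrite ler_pM // ?(ger0_norm b0') // sqrt_lipschitz.
have h1 : `|(e - e') / s| <=
    (Num.sqrt Q * `|b - b'| + S * (`|s - s'| / Num.sqrt D)) / D.
  rewrite normrM ler_pM // gtr0_norm ?invr_gt0 // lef_pV2 ?posrE //.
have h2 : `|e' * ((s' - s) / (s * s'))| <= `|s - s'| / D ^+ 2.
  rewrite normrM -[leRHS]mul1r ler_pM // ?(ger0_norm (expR_ge0 _)) //.
  rewrite normrM distrC ler_wpM2l // gtr0_norm ?invr_gt0 ?mulr_gt0 //.
  by rewrite lef_pV2 ?posrE ?mulr_gt0 ?exprn_gt0 // expr2 ler_pM // ltW.
rewrite (le_trans (lerD h1 h2)) // le_eqVlt; apply/orP; left; apply/eqP.
by field; rewrite !gt_eqF.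
Qed.

Definition coords_le (R : realType) (M : R) (x : space3 R) :=
  [/\ `|x.1.1| <= M, `|x.1.2| <= M & `|x.2| <= M].

Lemma sqdist_close (R : realType) (M h : R) (x y x' y' : space3 R) :
  coords_le M x -> coords_le M y -> coords_le M x' -> coords_le M y' ->
  ball x h x' -> ball y h y' -> `|sqdist x y - sqdist x' y'| <= 24 * M * h.
Proof.
have one (a b a' b' : R) : `|a| <= M -> `|b| <= M -> `|a'| <= M -> `|b'| <= M ->
    ball a h a' -> ball b h b' -> `|(a - b) ^+ 2 - (a' - b') ^+ 2| <= 8 * M * h.
  rewrite -!ball_normE /= => a1 b1 a1' b1' aa bb.
  have -> : (a - b) ^+ 2 - (a' - b') ^+ 2 =
    ((a - b) + (a' - b')) * ((a - a') - (b - b')) by ring.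
  rewrite normrM (_ : 8 * M * h = (4 * M) * (2 * h)); last by ring.
  rewrite ler_pM //.
    have := ler_normD (a - b) (a' - b'); have := ler_normB a b;
      have := ler_normB a' b'.
    by lra.
  have := ler_normB (a - a') (b - b'); lra.
move=> [x1 x2 x3] [y1 y2 y3] [x1' x2' x3'] [y1' y2' y3'] [[b1 b2] b3] [[c1 c2]
  c3].
have h1 := one _ _ _ _ x1 y1 x1' y1' b1 c1.
have h2 := one _ _ _ _ x2 y2 x2' y2' b2 c2.
have h3 := one _ _ _ _ x3 y3 x3' y3' b3 c3.
rewrite /sqdist; set u := _ ^+ 2 in h1 *.
move: h1 h2 h3; rewrite !ler_norml => /andP[? ?] /andP[? ?] /andP[? ?].
by apply/andP; split; lra.
Qed.

Lemma sqdist_le (R : realType) (M : R) (x y : space3 R) :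
  coords_le M x -> coords_le M y -> sqdist x y <= 12 * M ^+ 2.
Proof.
have one (a b : R) : `|a| <= M -> `|b| <= M -> (a - b) ^+ 2 <= 4 * M ^+ 2.
  move=> aM bM; rewrite (_ : 4 * M ^+ 2 = (2 * M) ^+ 2); last by ring.
  rewrite -[leLHS](real_normK (num_real _)) lerXn2r ?nnegrE //; last first.
    by have := ler_normB a b; lra.
  by have := normr_ge0 a; lra.
move=> [x1 x2 x3] [y1 y2 y3]; rewrite /sqdist.
by have := one _ _ x1 y1; have := one _ _ x2 y2; have := one _ _ x3 y3; lra.
Qed.

Lemma bounded_closure_compact (R : realType) (A : set (space3 R)) :
  bounded_set A ->
  exists2 M, (forall x, A x -> coords_le M x) & compact (closure A).
Proof.
move=> [M0 [_ hM]]; pose M := M0 + 1.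
have AM x : A x -> coords_le M x.
  move=> Ax; have : `|x| <= M.
    by have := hM M; rewrite ltrDl ltr01 => /(_ isT) /(_ x Ax).
  by rewrite !prod_normE !ge_max => /andP[/andP[? ?] ?]; split.
exists M => //.
pose box : set (space3 R) := (`[- M, M] `*` `[- M, M]) `*` `[- M, M].
have cbox : compact box by do 2?apply: compact_setX; exact: segment_compact.
apply: (subclosed_compact (@closed_closure _ _) cbox).
have -> : box = closure box.
  by apply/closure_id; apply: compact_closed cbox; exact: norm_hausdorff.
by apply: closureS => x /AM [? ? ?]; rewrite /box /= !in_itv /= -!ler_norml.
Qed.

(** The distance between the projections is attained, by compactness, and
    cannot be 0. It bounds r^2 from below and, as r is bounded on X * Y,
    also the sine of the polar angle. *)
Lemma disjoint_projections_dist (R : realType) (X Y : set (space3 R)) :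
  compact X -> compact Y -> X !=set0 -> Y !=set0 ->
  [disjoint fst @` X & fst @` Y] ->
  exists2 D : R, 0 < D & forall x y, X x -> Y y ->
    D <= (x.1.1 - y.1.1) ^+ 2 + (x.1.2 - y.1.2) ^+ 2.
Proof.
move=> cX cY [x0 Xx0] [y0 Yy0] /disj_setPS dXY.
pose f (p : space3 R * space3 R) : R :=
  (p.1.1.1 - p.2.1.1) ^+ 2 + (p.1.1.2 - p.2.1.2) ^+ 2.
have cf : continuous f.
  have proj (g : R * R -> R) : continuous g ->
      continuous (fun p : space3 R * space3 R => (g p.1.1 - g p.2.1) ^+ 2).
    move=> cg p; apply: (@continuous_comp _ _ _ (fun p : space3 R * space3 R =>
      g p.1.1 - g p.2.1) (fun t => t ^+ 2)); last exact: exprn_continuous.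
    apply: cvgB.
      apply: (@continuous_comp _ _ _ (fst \o fst) g); last exact: cg.
      by apply: continuous_comp; exact: cvg_fst.
    apply: (@continuous_comp _ _ _ (fst \o snd) g); last exact: cg.
    by apply: continuous_comp; [exact: cvg_snd | exact: cvg_fst].
  move=> p; apply: (@continuousD _ _ _ (fun p : space3 R * space3 R =>
    (p.1.1.1 - p.2.1.1) ^+ 2) (fun p => (p.1.1.2 - p.2.1.2) ^+ 2)).
    by apply: (proj fst) => t; exact: cvg_fst.
  by apply: (proj snd) => t; exact: cvg_snd.
have ne : X `*` Y !=set0 by exists (x0, y0).
have [[a b] /set_mem [/= Xa Yb] fmin] := compact_EVT_min ne
  (compact_setX cX cY) (continuous_subspaceT cf).
exists (f (a, b)).
  rewrite lt_neqAle addr_ge0 ?sqr_ge0 // andbT eq_sym paddr_eq0 ?sqr_ge0 //.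
  rewrite !sqrf_eq0 !subr_eq0 /=; apply/negP => /andP[/eqP e1 /eqP e2].
  apply: (dXY a.1); split; first by exists a.
  by exists b => //; move: e1 e2; case: (a.1) (b.1) => ? ? [? ?] /= -> ->.
by move=> x y Xx Yy; apply: (fmin (x, y)); rewrite inE.
Qed.

(** Moving both ends of a segment by at most h moves every point of it by at
    most h, so the mean of sigma along it inherits the modulus of
    continuity of sigma. *)
Lemma attenuation_uniform (R : realType) (Omega X Y : set (space3 R))
    (sigma : space3 R -> R) (S M D : R) :
  compact (closure Omega) -> {within closure Omega, continuous sigma} ->
  convex_set Omega -> (forall z, closure Omega z -> 0 <= sigma z <= S) ->
  X `<=` Omega -> Y `<=` Omega -> (forall x, Omega x -> coords_le M x) ->
  0 < D -> (forall x y, X x -> Y y -> D <= sqdist x y) ->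
  forall e, 0 < e -> exists2 h, 0 < h &
    forall x y x' y', X x -> Y y -> X x' -> Y y' ->
    ball x h x' -> ball y h y' ->
    `|attenuation sigma x y / sqdist x y
      - attenuation sigma x' y' / sqdist x' y'| <= e.
Proof.
move=> cO sO convO sS XO YO OM D0 XYD e e0.
have [[x0 Xx0]|nX] := pselect (X !=set0); last first.
  by exists 1 => // x y x' y' Xx; case: nX; exists x.
have M0 : 0 <= M by have [+ _ _] := OM _ (XO _ Xx0); apply: le_trans.
have S0 : 0 <= S.
  by have /andP[+ +] := sS _ (subset_closure (XO _ Xx0)); exact: le_trans.
have Q0 : 0 <= 12 * M ^+ 2 by rewrite mulr_ge0 // sqr_ge0.
have [A [B [A0 B0 AB]]] := attenuated_lipschitz D0 Q0 S0.
(* A + 1, B + 1 and 24 M + 1 instead of A, B and 24 M, which may vanish *)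
have eA : 0 < e / 2 / (A + 1) by rewrite !divr_gt0 // ltr_wpDl.
have eB : 0 < e / 2 / ((B + 1) * (24 * M + 1)).
  by rewrite !divr_gt0 // mulr_gt0 // ltr_wpDl // mulr_ge0.
have [h1 h10 H1] := compact_within_uniform cO sO eA.
exists (Num.min h1 (e / 2 / ((B + 1) * (24 * M + 1))));
  first by rewrite lt_min h10.
set h := Num.min _ _.
have hh1 : h <= h1 by rewrite ge_min lexx.
have hB : h <= e / 2 / ((B + 1) * (24 * M + 1)) by rewrite ge_min lexx orbT.
have h0 : 0 < h by rewrite lt_min h10.
move=> x y x' y' Xx Yy Xx' Yy' xx' yy'.
have [Ox Oy Ox' Oy'] := And4 (XO _ Xx) (YO _ Yy) (XO _ Xx') (YO _ Yy').
apply: (@le_trans _ _ (A * `|path_mean sigma x y - path_mean sigma x' y'|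
  + B * `|sqdist x y - sqdist x' y'|)).
  apply: AB; rewrite ?XYD ?sqdist_le ?(path_mean_bounds cO sO) //; exact: OM.
rewrite (splitr e) lerD //.
  apply: (@le_trans _ _ (A * (e / 2 / (A + 1)))); last first.
    by rewrite mulrCA ler_piMr ?(ltW (divr_gt0 _ _)) //
      ler_pdivrMr ?ltr_wpDl // mul1r lerDl.
  rewrite ler_wpM2l // (path_mean_dist cO sO) // => s s01.
  apply/ltW/H1; [apply: subset_closure; exact: segment_point_convex|
    apply: subset_closure; exact: segment_point_convex|].
  by apply: segment_point_close => //; exact: le_ball hh1 _ _.
apply: (@le_trans _ _ (B * (24 * M * (e / 2 / ((B + 1) * (24 * M + 1)))))).
  have hs : `|sqdist x y - sqdist x' y'| <= 24 * M * h.
    by apply: sqdist_close xx' yy'; exact: OM.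
  rewrite ler_wpM2l // (le_trans hs) //.
  by rewrite ler_wpM2l // mulr_ge0.
rewrite (_ : B * (24 * M * (e / 2 / ((B + 1) * (24 * M + 1)))) =
  e / 2 * ((B / (B + 1)) * (24 * M / (24 * M + 1)))); last first.
  by field; rewrite !gt_eqF // ltr_wpDl // mulr_ge0.
rewrite ler_piMr ?(ltW (divr_gt0 _ _)) //
  mulr_ile1 ?divr_ge0 ?addr_ge0 ?mulr_ge0 //.
  by rewrite ler_pdivrMr ?ltr_wpDl // mul1r lerDl.
by rewrite ler_pdivrMr ?ltr_wpDl ?mulr_ge0 // mul1r lerDl.
Qed.

(** * The kernel on a pair of cells *)

Lemma Gn0E (R : realType) (sigma : space3 R -> R) n (x y : space3 R) :
  0 < sqdist x y ->
  Gn0 sigma n x y = attenuation sigma x y / sqdist x y *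
    (Num.sqrt ((2 * n%:R + 1) / (4 * pi)) *
     (legendre n).[(x.2 - y.2) / Num.sqrt (sqdist x y)]).
Proof.
move=> s0; have e : enorm (x - y) = Num.sqrt (sqdist x y) by [].
have r0 : 0 < Num.sqrt (sqdist x y) by rewrite sqrtr_gt0.
rewrite /Gn0 /Yn0 /polar_angle e sqr_sqrtr ?ltW //= acosK;
  first by congr (_ * (_ * _.[_])); exact: mulrC.
have z_le : `|x.2 - y.2| <= Num.sqrt (sqdist x y).
  rewrite -sqrtr_sqr ler_wsqrtr // /sqdist lerDr.
  by rewrite addr_ge0 // sqr_ge0.
rewrite in_itv /= -ler_norml normrM normfV (gtr0_norm r0).
by rewrite ler_pdivrMl // mulr1.
Qed.

(** The normalization grows like n^(1/2), which is exactly what the decay of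
    P_n compensates. *)
Lemma sqr_harmonic_norm_le (R : realType) n : (0 < n)%N ->
  (2 * n%:R + 1) / (4 * pi) <= n%:R :> R.
Proof.
move=> n0; have p2 : 2 <= pi :> R by exact: pi_ge2.
have n1 : 1 <= n%:R :> R by rewrite ler1n.
rewrite ler_pdivrMr ?mulr_gt0 ?pi_gt0 //.
by move: n1 p2; move: (n%:R) (pi) => m p m1 p2; nra.
Qed.

(** 1 - cos^2 of the polar angle is the squared distance of the projections
    over the squared distance, hence at least D / Q. *)
Lemma normr_harmonic_le (R : realType) n (D Q : R) (x y : space3 R) :
  (0 < n)%N -> 0 < D ->
  D <= (x.1.1 - y.1.1) ^+ 2 + (x.1.2 - y.1.2) ^+ 2 -> sqdist x y <= Q ->
  `|Num.sqrt ((2 * n%:R + 1) / (4 * pi)) *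
    (@legendre R n).[(x.2 - y.2) / Num.sqrt (sqdist x y)]| <= Num.sqrt (Q / D).
Proof.
move=> n0 D0 Dxy sQ.
have s0 : 0 < sqdist x y.
  by rewrite (lt_le_trans D0) // (le_trans Dxy) // lerDl sqr_ge0.
have Q0 : 0 < Q by exact: lt_le_trans sQ.
rewrite -(@ler_pXn2r _ 2) ?nnegrE ?sqrtr_ge0 // sqr_sqrtr;
  last by rewrite divr_ge0 ?ltW.
rewrite real_normK ?num_real // exprMn sqr_sqrtr; last first.
  by apply: divr_ge0; [rewrite addr_ge0 ?mulr_ge0 | rewrite mulr_ge0 ?pi_ge0].
set t := (x.2 - y.2) / _; set p := _.[t].
have tE : 1 - t ^+ 2 = ((x.1.1 - y.1.1) ^+ 2 + (x.1.2 - y.1.2) ^+ 2)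
  / sqdist x y.
  rewrite /t expr_div_n sqr_sqrtr ?ltW // /sqdist; field.
  by rewrite -[_ + _]/(sqdist x y) gt_eqF.
have tD : D / Q <= 1 - t ^+ 2.
  rewrite tE; apply: ler_pM => //; first exact: ltW.
    by rewrite invr_ge0 ltW.
  by rewrite lef_pV2.
have := legendre_le n t; rewrite -/p => h.
rewrite (le_trans (ler_wpM2r (sqr_ge0 _) (sqr_harmonic_norm_le R n0))) //.
rewrite -(@ler_pM2l _ (D / Q)) ?divr_gt0 // (_ : D / Q * (Q / D) = 1);
  last first.
  by field; rewrite !gt_eqF.
rewrite (le_trans _ h) // mulrCA -mulrA ler_wpM2l // ler_wpM2r ?sqr_ge0 //.
Qed.

Lemma legendre_cell_approx (R : realType) n (c : R) : 0 < c ->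
  exists2 h : space3 R -> space3 R -> R, separated (3 * n).+1 h &
    forall x y, `|sqdist x y - c| <= c / 256 ->
      `|(legendre n).[(x.2 - y.2) / Num.sqrt (sqdist x y)] - h x y|
        <= 2 / 4 ^+ n.
Proof.
move=> c0; have [H sH HP] := legendre_local_approx n c0.
exists (fun x y => \sum_(j < n.+1) (x.2 - y.2) ^+ j * (H j).[sqdist x y]).
  apply: (@separated_sum _ _ n.+1
    (fun j x y => (x.2 - y.2) ^+ j * (H j).[sqdist x y])) => j jn.
  exact: separated_horner_sqdist.
by move=> x y xyc; apply: HP => //; rewrite /sqdist lerDr addr_ge0 // sqr_ge0.
Qed.

(** The error splits as (F(x,y) - F(x0,y0)) Y + F(x0,y0) (Y - approximant).
    The first term is small by the choice of the cells, the second one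
    because n is large. *)
Lemma near_constant_cell_approx (R : realType) (X Y : set (space3 R))
    (sigma : space3 R -> R) (M D e1 h : R) n x0 y0 : (0 < n)%N ->
  (forall x, X x -> coords_le M x) -> (forall y, Y y -> coords_le M y) ->
  0 < D ->
  (forall x y, X x -> Y y ->
     D <= (x.1.1 - y.1.1) ^+ 2 + (x.1.2 - y.1.2) ^+ 2) ->
  24 * M * h <= D / 256 ->
  (forall x y, X x -> Y y -> ball x0 h x -> ball y0 h y ->
     `|attenuation sigma x y / sqdist x y
       - attenuation sigma x0 y0 / sqdist x0 y0| <= e1) ->
  attenuation sigma x0 y0 <= 1 -> X x0 -> Y y0 ->
  exists2 k, separated (3 * n).+1 k & forall x y, X x -> Y y ->
    ball x0 h x -> ball y0 h y ->
    `|Gn0 sigma n x y - k x y|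
      <= e1 * Num.sqrt (12 * M ^+ 2 / D) + D^-1 * (2 / 2 ^+ n).
Proof.
move=> n0 XM YM D0 XYD hD osc att1 Xx0 Yy0.
have sD x y : X x -> Y y -> D <= sqdist x y.
  by move=> Xx Yy; rewrite (le_trans (XYD _ _ Xx Yy)) // lerDl sqr_ge0.
have c0 : 0 < sqdist x0 y0 by exact: lt_le_trans (sD _ _ Xx0 Yy0).
have [P sP PP] := legendre_cell_approx n c0.
set F := fun x y => attenuation sigma x y / sqdist x y in osc *.
pose q : R := Num.sqrt ((2 * n%:R + 1) / (4 * pi)).
exists (fun x y => (F x0 y0 * q) * P x y); first exact: separatedZ.
move=> x y Xx Yy bx by_.
rewrite Gn0E; last exact: lt_le_trans (sD _ _ Xx Yy).
rewrite -/(F x y) -/q; set p := (legendre n).[_].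
have -> : F x y * (q * p) - F x0 y0 * q * P x y =
  (F x y - F x0 y0) * (q * p) + F x0 y0 * (q * (p - P x y)) by ring.
rewrite (le_trans (ler_normD _ _)) // lerD // normrM ler_pM //.
- exact: osc.
- apply: normr_harmonic_le => //; first exact: XYD.
  by apply: sqdist_le; [exact: XM | exact: YM].
- rewrite ger0_norm; last by rewrite divr_ge0 ?expR_ge0 // ltW.
  rewrite /F -[leRHS]mul1r ler_pM ?expR_ge0 //; first by rewrite invr_ge0 ltW.
  by rewrite lef_pV2 ?posrE // sD.
- have pP : `|p - P x y| <= 2 / 4 ^+ n.
    apply: PP; rewrite distrC.
    apply: (le_trans (sqdist_close (M := M) (h := h) _ _ _ _ _ _)) => //;
      [exact: XM|exact: YM|exact: XM|exact: YM|].
    by rewrite (le_trans hD) // ler_pM2r ?invr_gt0 // sD.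
  have q2 : q <= 2 ^+ n.
    rewrite -(@ler_pXn2r _ 2) ?nnegrE ?sqrtr_ge0 ?exprn_ge0 // sqr_sqrtr;
      last first.
      by apply: divr_ge0; [rewrite addr_ge0 ?mulr_ge0 | rewrite mulr_ge0
        ?pi_ge0].
    rewrite (le_trans (sqr_harmonic_norm_le R n0)) // -!natrX ler_nat.
    rewrite (leq_trans (ltnW (ltn_expl n (ltnSn 1)))) //.
    by rewrite -expnM leq_exp2l // leq_pmulr.
  rewrite normrM (ger0_norm (sqrtr_ge0 _)).
  apply: (@le_trans _ _ (2 ^+ n * (2 / 4 ^+ n)));
    first by rewrite ler_pM ?sqrtr_ge0.
  rewrite (_ : 4 ^+ n = 2 ^+ n * 2 ^+ n); last first.
    by rewrite -exprMn; congr (_ ^+ n); lra.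
  rewrite le_eqVlt; apply/orP; left; apply/eqP; field.
  by rewrite expf_neq0.
Qed.

(** * Gluing the cells *)

(** At a given (x, y) only one pair of cells contributes to the sum. *)
Lemma glue_cells (R : realType) (I : finType) (L : nat)
    (B : I -> set (space3 R)) (X Y : set (space3 R))
    (G : space3 R -> space3 R -> R) (eps : R) :
  compact X -> compact Y -> (forall i, measurable (B i : set (mspace3 R))) ->
  (forall x, X x \/ Y x -> exists i, forall j, B j x <-> j = i) ->
  (forall i j, exists2 h, separated L h & forall x y,
     X x -> B i x -> Y y -> B j y -> `|G x y - h x y| <= eps) ->
  exists f g : 'I_(#|I| ^ 2 * L ^ 3) -> space3 R -> R,
  [/\ forall l, Linfty X (f l), forall l, Linfty Y (g l) &
      forall x y, X x -> Y y -> `|G x y - \sum_l f l x * g l y| <= eps].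
Proof.
move=> cX cY mB part approx.
have /choice [g gP] : forall ij : I * I,
    exists g : 'I_L * 'I_L * 'I_L -> space3 R -> R,
    (forall a, continuous (g a)) /\
    (forall x y, X x -> B ij.1 x -> Y y -> B ij.2 y ->
      `|G x y - \sum_a monomial3 a x * g a y| <= eps).
  move=> [i j]; have [h [g gc hE] hG] := approx i j.
  by exists g; split => // x y Xx Bx Yy By; rewrite -hE; exact: hG.
pose T : finType := ((I * I) * ('I_L * 'I_L * 'I_L))%type.
have <- : #|T| = (#|I| ^ 2 * L ^ 3)%N.
  by rewrite !card_prod !card_ord !expnS !expn0; lia.
pose F (t : T) (x : space3 R) : R := \1_(B t.1.1) x * monomial3 t.2 x.
pose H (t : T) (y : space3 R) : R := \1_(B t.1.2) y * g t.1 t.2 y.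
have Linf Z i (u : space3 R -> R) : compact Z -> continuous u ->
    Linfty Z (fun x => \1_(B i) x * u x).
  move=> cZ cu; have [M MP] := compact_continuous_bounded cZ cu.
  apply: (@Linfty_bounded _ _ _ M).
  - exact: compact_measurable3.
  - apply: measurable_funM; first exact: measurable_indic.
    exact: continuous_measurable3.
  - move=> x Zx; rewrite normrM indicE (le_trans _ (MP _ Zx)) //.
    by case: (_ \in _); rewrite ?normr1 ?mul1r // normr0 mul0r.
have cmono a : continuous (@monomial3 R L a).
  have pw (p : space3 R -> R) k :
      continuous p -> continuous (fun x => p x ^+ k).
    by move=> cp x; apply: (@continuous_comp _ _ _ p (fun t => t ^+ k));
      [exact: cp | exact: exprn_continuous].
  move=> x; apply: (@continuousM _ _
    (fun x : space3 R => x.1.1 ^+ a.1.1 * x.1.2 ^+ a.1.2)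
      (fun x => x.2 ^+ a.2)).
    apply: (@continuousM _ _ (fun x : space3 R => x.1.1 ^+ a.1.1)
      (fun x => x.1.2 ^+ a.1.2)).
      by apply: (pw (fst \o fst)) => z; apply: continuous_comp; exact: cvg_fst.
    by apply: (pw (snd \o fst)) => z; apply: continuous_comp;
      [exact: cvg_fst | exact: cvg_snd].
  by apply: pw => z; exact: cvg_snd.
exists (fun l => F (enum_val l)), (fun l => H (enum_val l)); split.
- by move=> l; apply: Linf.
- by move=> l; apply: Linf => //; exact: (gP _).1.
move=> x y Xx Yy.
have [i iP] := part x (or_introl Xx); have [j jP] := part y (or_intror Yy).
rewrite -(big_enum_val (fun t => F t x * H t y)) /=.
rewrite (_ : \sum_(t in T) F t x * H t y = \sum_a monomial3 a x * g (i, j) a y).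
  by apply: (gP (i, j)).2; rewrite //= ?iP ?jP.
rewrite -(pair_bigA _ (fun p a => F (p, a) x * H (p, a) y)) /=.
rewrite (bigD1 (i, j)) //= [X in _ + X]big1 ?addr0 => [|[i' j'] ne].
  apply: eq_bigr => a _; rewrite /F /H /= !indicE !mem_set ?mul1r //;
    first exact/jP.
  exact/iP.
rewrite big1 // => a _; rewrite /F /H /= !indicE.
have [/iP ii|nB] := pselect (B i' x); last by rewrite memNset // !mul0r.
have [/jP jj|nB] := pselect (B j' y);
  last by rewrite [y \in _]memNset // mul0r mulr0.
by move: ne; rewrite ii jj eqxx.
Qed.

Lemma rank_bound (R : realType) (K : nat) (delta : R) : 0 < delta ->
  exists n0 : nat, forall n, (n0 <= n)%N ->
    (K * (3 * n).+1 ^ 3)%:R <= n%:R `^ (3 + delta) :> R.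
Proof.
move=> d0; pose Z : R := (64 * K)%:R `^ delta^-1.
exists (Num.truncn Z).+1 => n Zn.
have n0 : (0 < n)%N by exact: leq_trans Zn.
have nZ : Z <= n%:R.
  by rewrite ltW // (lt_le_trans (truncnS_gt _)) // ler_nat.
have KZ : (64 * K)%:R <= n%:R `^ delta.
  rewrite (_ : (64 * K)%:R = Z `^ delta).
    by rewrite ge0_ler_powR ?nnegrE ?powR_ge0 // ltW.
  by rewrite /Z -powRrM mulVf ?gt_eqF // powRr1.
rewrite powRD; last by rewrite pnatr_eq0 -lt0n n0 implybT.
rewrite powR_mulrn // mulrC.
apply: (@le_trans _ _ ((64 * K)%:R * n%:R ^+ 3));
  last by rewrite ler_wpM2r ?exprn_ge0.
rewrite -natrX -natrM ler_nat -mulnA [X in (_ <= X)%N]mulnCA leq_mul2l.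
(* 3 n + 1 <= 4 n, and 4^3 = 64 *)
apply/orP; right; rewrite -[64%N]/(4 ^ 3)%N -expnMn leq_exp2r //; lia.
Qed.

Theorem theorem3p15 (R : realType)
    (Omega : set (space3 R)) (k : nat) (sigma_t : space3 R -> R)
    (sigma0 sigma1 : R) (X Y : set (space3 R))
    (Omega_domain : domain Omega) (Omega_bounded : bounded_set Omega)
    (Omega_convex : convex_set Omega)
    (k_ge1 : (1 <= k)%N) (sigma_t_C : Cclosure k.+1 Omega sigma_t)
    (sigma0_gt0 : 0 < sigma0)
    (sigma_t_bounds :
      forall x, closure Omega x -> sigma0 <= sigma_t x <= sigma1)
    (X_domain : compact_domain X) (Y_domain : compact_domain Y)
    (X_Omega : X `<=` Omega) (Y_Omega : Y `<=` Omega)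
    (XY_disjoint : [disjoint fst @` X & fst @` Y]) :
  exists C : R, forall eps delta : R, 0 < eps -> 0 < delta ->
  exists n0 : nat, forall n : nat, (n0 <= n)%N ->
  exists (N : nat) (f g : 'I_N -> space3 R -> R),
    [/\ N%:R <= C * n%:R `^ (3 + delta),
        forall l, Linfty X (f l),
        forall l, Linfty Y (g l) &
        (Linfty_norm2 X Y
           (fun x y => (Gn0 sigma_t n x y - \sum_(l < N) f l x * g l y)%R)
         <= eps%:E)%E].
Proof.
have [cX [U [_ _ [x0 Ux0]] XU]] := X_domain.
have [cY [V [_ _ [y0 Vy0]] YV]] := Y_domain.
have X0 : X !=set0 by exists x0; rewrite XU; exact: subset_closure.
have Y0 : Y !=set0 by exists y0; rewrite YV; exact: subset_closure.
have [M OM cO] := bounded_closure_compact Omega_bounded.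
have XM x : X x -> coords_le M x by move=> /X_Omega/OM.
have YM y : Y y -> coords_le M y by move=> /Y_Omega/OM.
have M0 : 0 <= M by have [x /XM [+ _ _]] := X0; apply: le_trans.
have sO : {within closure Omega, continuous sigma_t} by case: sigma_t_C.
have sS z : closure Omega z -> 0 <= sigma_t z <= sigma1.
  by move=> /sigma_t_bounds /andP[/(le_trans (ltW sigma0_gt0)) -> ->].
have [D D0 XYD] := disjoint_projections_dist cX cY X0 Y0 XY_disjoint.
have sD x y : X x -> Y y -> D <= sqdist x y.
  by move=> Xx Yy; rewrite (le_trans (XYD _ _ Xx Yy)) // lerDl sqr_ge0.
exists 1 => eps delta eps0 delta0.
pose Q : R := Num.sqrt (12 * M ^+ 2 / D).
have Q0 : 0 <= Q by exact: sqrtr_ge0.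
have e10 : 0 < eps / 2 / (Q + 1) by rewrite !divr_gt0 // ltr_wpDl.
have [h h0 osc] := attenuation_uniform cO sO Omega_convex sS X_Omega Y_Omega OM
  D0 sD e10.
(* h controls the factor F, and D / (256 (24 M + 1)) the variation of r^2 *)
pose h' := Num.min h (D / 256 / (24 * M + 1)).
have M1 : 0 < 24 * M + 1 by rewrite ltr_wpDl // mulr_ge0.
have h'0 : 0 < h' by rewrite lt_min h0 !divr_gt0.
have h'h : h' <= h by rewrite ge_min lexx.
have h'D : 24 * M * h' <= D / 256.
  apply: (@le_trans _ _ (24 * M * (D / 256 / (24 * M + 1)))).
    by rewrite ler_wpM2l ?mulr_ge0 // ge_min lexx orbT.
  by rewrite mulrA ler_pdivrMr // mulrC ler_wpM2l ?divr_ge0 ?(ltW D0) // lerDl.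
have [K [B [mB closeB partB]]] := bounded_grid M h'0.
have [n1 rankn] := rank_bound (#|{: 'I_K * 'I_K * 'I_K}| ^ 2) delta0.
(* 4 / (D eps) <= n <= 2^n makes the error D^-1 2 / 2^n at most eps / 2 *)
pose n2 := (Num.truncn (4 / (D * eps))).+1.
exists (maxn n1 n2) => n; rewrite geq_max => /andP[/rankn rank n2n].
have n_gt0 : (0 < n)%N by exact: leq_trans n2n.
have tail : D^-1 * (2 / 2 ^+ n) <= eps / 2.
  have : 4 / (D * eps) <= 2 ^+ n.
    rewrite ltW // (lt_le_trans (truncnS_gt _)) // -natrX ler_nat.
    by rewrite (leq_trans n2n) // ltnW // ltn_expl.
  rewrite ler_pdivrMr ?mulr_gt0 // mulrA ler_pdivrMr ?exprn_gt0 //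
    ler_pdivrMl //.
  by move: (2 ^+ n) => A ?; lra.
have [||f [g [Lf Lg fg]]] := @glue_cells R _ (3 * n).+1 B X Y (Gn0 sigma_t n)
  eps cX cY mB.
- by move=> x [/XM|/YM] [? ? ?]; exact: partB.
- move=> i j.
  have [[[x y] [/= Xx Bx Yy By]]|none] := pselect
      (exists p : space3 R * space3 R, [/\ X p.1, B i p.1, Y p.2 & B j p.2]);
    last first.
    (* the cells contain no point of X * Y, so nothing has to be approximated *)
    exists (fun _ _ => 0); first exact: separated0.
    by move=> x y Xx Bx Yy By; case: none; exists (x, y).
  have [||P sP PG] := @near_constant_cell_approx R X Y sigma_t M D
      (eps / 2 / (Q + 1)) h' n x y n_gt0 XM YM D0 XYD h'D _ _ Xx Yy.
  + move=> x' y' Xx' Yy' bx by_; rewrite distrC; apply: osc => //.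
      exact: le_ball h'h _ bx.
    exact: le_ball h'h _ by_.
  + rewrite expR_le1 mulNr oppr_le0 mulr_ge0 ?sqrtr_ge0 //.
    by have /andP[] := path_mean_bounds cO sO Omega_convex (X_Omega _ Xx)
      (Y_Omega _ Yy) sS.
  exists P => // x' y' Xx' Bx' Yy' By'.
  rewrite (le_trans (PG _ _ Xx' Yy' (closeB _ _ _ Bx Bx')
    (closeB _ _ _ By By'))) //.
  rewrite [leRHS]splitr lerD // -/Q mulrAC ler_pdivrMr ?ltr_wpDl //.
  by rewrite ler_wpM2l ?divr_ge0 ?(ltW eps0) // lerDl.
exists (#|{: 'I_K * 'I_K * 'I_K}| ^ 2 * (3 * n).+1 ^ 3)%N, f, g; split => //.
  by rewrite mul1r.
by apply: Linfty_norm2_le; first exact: ltW.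
Qed.
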